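(* Let $T>0$. (i) If $\zeta_1:]-T,T[\rightarrow\mathbb{H}$ and $\zeta_2:]-T,T[\rightarrow\mathbb{H}$ are two smooth horizontal curves parametrized by arc length in the Heisenberg group $\mathbb{H}$ such that $h_{\zeta_1}(t)=h_{\zeta_2}(t)$ for every $t\in\,]-T,T[$, then there exists an isometry $\iota$ of the Heisenberg group such that $\zeta_2=\iota\circ\zeta_1$. (ii) Let $\zeta:]-T,T[\rightarrow\mathbb{H}$ be a smooth horizontal curve parametrized by arc length. The derivative $\dot h_\zeta$ of its characteristic deviation is identically equal to zero along $\zeta$ if and only if $\zeta$ is a geodesic.
   Context: The Heisenberg group $\mathbb{H}$ is $\mathbb{R}^3$ with coordinates $(x,y,z)$, endowed with the two-dimensional distribution spanned by $X_1=\frac{\partial}{\partial x}-\frac{y}{2}\frac{\partial}{\partial z}$ and $X_2=\frac{\partial}{\partial y}+\frac{x}{2}\frac{\partial}{\partial z}$, with the metric on the distribution for which $(X_1,X_2)$ is an orthonormal frame. A horizontal curve is a Lipschitz curve that is almost everywhere tangent to the distribution, whose velocity components with respect to $(X_1,X_2)$ are measurable and essentially bounded; its length is the integral of the norm of its velocity (norm with respect to the orthonormal frame $(X_1,X_2)$). The distance $d_{\mathbb{H}}(A,B)$ is the infimum of the lengths of horizontal curves joining $A$ to $B$; an isometry of $\mathbb{H}$ is a bijection preserving $d_{\mathbb{H}}$. A smooth ($\mathcal{C}^\infty$) curve is horizontal if and only if it is everywhere tangent to the distribution, and it is parametrized by arc length if its velocity has norm $1$ everywhere. For a smooth horizontal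 curve $\zeta(t)=(x(t),y(t),z(t))$ parametrized by arc length, the characteristic deviation is $h_\zeta(t)=\dot x(t)\ddot y(t)-\dot y(t)\ddot x(t)$. A geodesic is a horizontal curve $\gamma$ parametrized at constant speed on an interval such that, for any $t$ in the interval and any $s$ in the interval close enough to $t$, the length of $\gamma$ between times $t$ and $s$ equals $d_{\mathbb{H}}(\gamma(t),\gamma(s))$. *)

(* Defs.v *)
From mathcomp Require Import all_boot all_order all_algebra.
From mathcomp Require Import all_classical all_reals all_analysis.
Set Implicit Arguments.
Unset Strict Implicit.
Unset Printing Implicit Defensive.
Import Order.TTheory GRing.Theory Num.Theory.
Import numFieldNormedType.Exports.
Local Open Scope classical_set_scope.
Local Open Scope ring_scope.

(* Curves are total functions R -> H; only their values on the interval under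
   consideration are meant to be used. *)

Notation heis R := (R * R * R)%type.

Section Heisenberg.
Context {R : realType}.

Local Notation heis := (heis R).

Definition cx (p : heis) : R := p.1.1.
Definition cy (p : heis) : R := p.1.2.

Definition X1 (p : heis) : heis := (1, 0, - (cy p / 2)).
Definition X2 (p : heis) : heis := (0, 1, cx p / 2).

Definition horizontal_vector (p : heis) (u : R * R) : heis :=
  u.1 *: X1 p + u.2 *: X2 p.

(* norm of [horizontal_vector p u] in the metric making (X1, X2) orthonormal *)
Definition hnorm (u : R * R) : R := Num.sqrt (u.1 ^+ 2 + u.2 ^+ 2).

(* The curve [g] has at time [t] a horizontal velocity, whose components with
   respect to (X1, X2) are [u]. *)
Definition has_velocity (g : R -> heis) (t : R) (u : R * R) : Prop :=
  is_derive t (1 : R) g (horizontal_vector (g t) u).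

Local Notation mu := (@lebesgue_measure R).

(* [g] is a horizontal curve on [I] with velocity components [u]; these are
   determined almost everywhere by [g]. *)
Definition horizontal (I : interval R) (g : R -> heis) (u : R -> R * R) : Prop :=
  [/\ [lipschitz g t | t in [set` I]],
      measurable_fun [set` I] (fun t => (u t).1),
      measurable_fun [set` I] (fun t => (u t).2),
      exists M : R, {ae mu, forall t, t \in I -> hnorm (u t) <= M}
    & {ae mu, forall t, t \in I -> has_velocity g t (u t)}].

Definition hlength (I : interval R) (u : R -> R * R) : \bar R :=
  (\int[mu]_(t in [set` I]) (hnorm (u t))%:E)%E.

Definition dH (A B : heis) : \bar R :=
  ereal_inf [set l | exists (a b : R) (g : R -> heis) (u : R -> R * R),
    [/\ a <= b, horizontal `[a, b] g u, g a = A, g b = B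
      & l = hlength `[a, b] u]].

Definition heis_isometry (f : heis -> heis) : Prop :=
  bijective f /\ forall A B, dH (f A) (f B) = dH A B.

Definition geodesic (I : interval R) (g : R -> heis) : Prop :=
  exists u : R -> R * R,
    [/\ horizontal I g u,
        exists c : R, {ae mu, forall t, t \in I -> hnorm (u t) = c}
      & forall t, t \in I -> \forall s \near t, s \in I ->
          hlength `[Num.min t s, Num.max t s] u = dH (g t) (g s)].

(* Meant for open intervals only: the derivatives are two-sided. *)
Definition smooth_on (I : interval R) (g : R -> heis) : Prop :=
  forall (n : nat) (t : R), t \in I -> derivable (derive1n n g) t 1.

Definition smooth_horizontal_arclength (I : interval R) (g : R -> heis) : Prop :=
  smooth_on I g /\
  forall t, t \in I -> exists u : R * R, has_velocity g t u /\ hnorm u = 1.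

Definition char_deviation (g : R -> heis) (t : R) : R :=
  let x := cx \o g in
  let y := cy \o g in
  derive1 x t * derive1n 2 y t - derive1 y t * derive1n 2 x t.

End Heisenberg.

(* Main.v *)
(* Part (i): if u is the velocity of an arc-length horizontal curve, written in
   the frame (X1, X2), then u' = h J u with J the quarter turn. For two curves
   with the same h the numbers <u, v> and <J u, v> are therefore constant, so a
   fixed rotation carries one velocity onto the other; composed with a left
   translation, it carries one curve onto the other.

   Constant curvature k implies local minimality by calibration: after a
   motion sending the point to the origin and the velocity to X1, the curve
   satisfies v = (sqrt (1 - (k x)^2), k x), which is the horizontal gradient of
   F (x, y, z) = G x + k (z + x y / 2) when G' x = sqrt (1 - (k x)^2). As this
   gradient is a unit vector where |k x| <= 1, F grows at most as fast as
   length along any competitor, and exactly as fast as length along the curve.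

   Conversely, if h' <> 0 near a point, add e phi v to the projection to the
   plane, with v a constant vector: as v is parallel to itself, the change of
   the swept area is exactly linear in e. Taking phi = psi' / (v x u) with psi
   vanishing to second order at both ends makes that change vanish, while the
   first variation of the length is - e (integral of h' psi), which is nonzero
   since h' has a sign; a small e of the right sign shortens the curve. *)
Require Import Defs.
From mathcomp Require Import all_boot all_order all_algebra.
From mathcomp Require Import all_classical all_reals all_analysis.
From mathcomp Require Import measurable_realfun.
From mathcomp Require Import ring lra.
Import Order.TTheory GRing.Theory Num.Theory.
Import numFieldNormedType.Exports.
Local Open Scope classical_set_scope.
Local Open Scope ring_scope.

(** * Rules of differentiation for real functions written as explicit abstractions *)

Section ScalarDerivatives.
Set Implicit Arguments.
Unset Strict Implicit.
Context {R : realType}.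
Implicit Types (f g : R -> R) (t a b : R).

Lemma derive_cstf (c t : R) : is_derive t (1 : R) (fun=> c) 0.
Proof. exact: is_derive_cst. Qed.

Lemma derive_idf t : is_derive t (1 : R) (fun s : R => s) 1.
Proof. exact: is_derive_id. Qed.

Lemma derive_addf f g t a b : is_derive t (1 : R) f a ->
  is_derive t (1 : R) g b -> is_derive t (1 : R) (fun s => f s + g s) (a + b).
Proof. by move=> *; apply: is_deriveD. Qed.

Lemma derive_oppf f t a : is_derive t (1 : R) f a ->
  is_derive t (1 : R) (fun s => - f s) (- a).
Proof. by move=> *; apply: is_deriveN. Qed.

Lemma derive_mulf f g t a b : is_derive t (1 : R) f a ->
  is_derive t (1 : R) g b ->
  is_derive t (1 : R) (fun s => f s * g s) (a * g t + f t * b).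
Proof.
move=> fa gb; have := @is_deriveM _ _ f g t 1 a b fa gb.
by rewrite /GRing.scale /= addrC [g t * a]mulrC.
Qed.

Lemma derive_compf f g t a b : is_derive (g t) (1 : R) f a ->
  is_derive t (1 : R) g b -> is_derive t (1 : R) (fun s => f (g s)) (a * b).
Proof. by move=> *; apply: (is_derive1_comp (f := f) (g := g)). Qed.

Lemma derive_invf f t a : f t != 0 -> is_derive t (1 : R) f a ->
  is_derive t (1 : R) (fun s => (f s)^-1) (- a / f t ^+ 2).
Proof.
move=> ft0 fa; have := @is_deriveV _ f t a 1 ft0 fa.
by rewrite /GRing.scale /= mulNr mulrC mulNr.
Qed.

Lemma derive_expf f n t a : is_derive t (1 : R) f a ->
  is_derive t (1 : R) (fun s => f s ^+ n) (n%:R * f t ^+ n.-1 * a).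
Proof.
move=> fa; have := @is_deriveX _ _ f n t 1 a fa.
by rewrite /GRing.scale /= (_ : (f ^+ n)%R = fun s => f s ^+ n)//; apply/funext => s; rewrite exprfctE.
Qed.

Lemma is_derive_continuous f t a : is_derive t (1 : R) f a -> {for t, continuous f}.
Proof. by case=> fd _; apply/differentiable_continuous/derivable1_diffP. Qed.

Lemma is_derive_inj f t a b : is_derive t (1 : R) f a ->
  is_derive t (1 : R) f b -> a = b.
Proof. by case=> _ <- [_ <-]. Qed.

Lemma is_derive_near f g t a : (\forall s \near t, f s = g s) ->
  is_derive t (1 : R) f a -> is_derive t (1 : R) g a.
Proof. by move=> fg; exact: near_eq_is_derive. Qed.

End ScalarDerivatives.

(** Follows the syntax of the function and takes the derivatives of its unknown parts from the
    context. The value is left open and assembled on the way; [derive by] compares it with the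
    intended one only at the end. *)
Ltac der_rule := first
  [ eassumption
  | lazymatch goal with
    | |- is_derive _ _ (fun=> ?c) _ => exact: derive_cstf
    | |- is_derive _ _ (fun s => s) _ => exact: derive_idf
    | |- is_derive _ _ (fun s => @?f s + @?g s) _ =>
        eapply (@derive_addf _ f g); der_rule
    | |- is_derive _ _ (fun s => - @?f s) _ => eapply (@derive_oppf _ f); der_rule
    | |- is_derive _ _ (fun s => @?f s * @?g s) _ =>
        eapply (@derive_mulf _ f g); der_rule
    | |- is_derive _ _ (fun s => @?f s ^+ ?n) _ =>
        eapply (@derive_expf _ f n); der_rule
    end ].

Tactic Notation "derive" "by" tactic(tac) := (eapply is_derive_eq; [der_rule | tac]).

(** * Derivatives, horizontality and Lipschitz bounds in coordinates *)

Section Components.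
Set Implicit Arguments.
Unset Strict Implicit.
Context {R : realType}.

Lemma is_derive_pair (V W : normedModType R) (f : R -> V) (g : R -> W)
    (t : R) (a : V) (b : W) :
  is_derive t (1 : R) (fun s => (f s, g s)) (a, b) <->
  is_derive t (1 : R) f a /\ is_derive t (1 : R) g b.
Proof.
(* Differentiability with value [c] is convergence of the difference quotient to [c], and
   convergence in a product is componentwise. *)
have key (X : normedModType R) (k : R -> X) (c : X) :
    is_derive t (1 : R) k c <->
    h^-1 *: ((k \o shift t) (h *: 1) - k t) @[h --> (0 : R)^'] --> c.
  split; first by case=> kd <-.
  by move=> kc; split; [apply: cvgP kc | apply: cvg_lim].
rewrite !key; split => [ab|[fa gb]].
  split; [have := cvg_comp _ _ ab (@cvg_fst _ _ (nbhs a) (nbhs b) _)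
         | have := cvg_comp _ _ ab (@cvg_snd _ _ (nbhs a) (nbhs b) _)]; exact.
exact: (cvg_pair fa gb).
Qed.

Definition cz (p : heis R) : R := p.2.

Lemma is_derive_heisP (g : R -> heis R) (t : R) (v : heis R) :
  is_derive t (1 : R) g v <->
  [/\ is_derive t (1 : R) (fun s => cx (g s)) (cx v),
      is_derive t (1 : R) (fun s => cy (g s)) (cy v)
    & is_derive t (1 : R) (fun s => cz (g s)) (cz v)].
Proof.
have -> : g = fun s => (cx (g s), cy (g s), cz (g s)).
  by apply/funext => s; case: (g s) => [[]].
by case: v => [[a b] c]; rewrite !is_derive_pair /cx /cy /cz /=; split => [[[]]|[]].
Qed.

(** Horizontality in coordinates: the height changes at the rate at which the projection to the
    plane sweeps area seen from the origin. *)
Lemma has_velocityP (g : R -> heis R) (t : R) (u : R * R) :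
  has_velocity g t u <->
  [/\ is_derive t (1 : R) (fun s => cx (g s)) u.1,
      is_derive t (1 : R) (fun s => cy (g s)) u.2
    & is_derive t (1 : R) (fun s => cz (g s))
        ((cx (g t) * u.2 - cy (g t) * u.1) / 2)].
Proof.
rewrite /has_velocity is_derive_heisP.
suff -> : horizontal_vector (g t) u =
    (u.1, u.2, (cx (g t) * u.2 - cy (g t) * u.1) / 2) by [].
rewrite /horizontal_vector /X1 /X2; case: u => u1 u2 /=.
congr (_, _, _).
- by change (u1 * 1 + u2 * 0 = u1); ring.
- by change (u1 * 0 + u2 * 1 = u2); ring.
- change (u1 * - (cy (g t) / 2) + u2 * (cx (g t) / 2) =
    (cx (g t) * u2 - cy (g t) * u1) / 2); ring.
Qed.

(** Replaces a condition on all large enough constants by one explicit constant, of unspecified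
    sign. *)
Lemma lipschitzP (V : normedModType R) (I : interval R) (g : R -> V) :
  [lipschitz g t | t in [set` I]] <->
  exists k, forall s t, s \in I -> t \in I -> `|g s - g t| <= k * `|s - t|.
Proof.
split.
  rewrite /lipschitz_on; move=> [k [_ /(_ (k + 1))]].
  rewrite ltrDl ltr01 => /(_ isT) kg; exists (k + 1) => s t sI tI.
  exact: (kg (s, t)).
case=> k kg; exists k; split; first exact: num_real.
move=> l kl [s t] [/= sI tI]; apply: le_trans (kg s t sI tI) _.
by rewrite ler_wpM2r// ltW.
Qed.

Lemma lipschitz_heisP (I : interval R) (g : R -> heis R) :
  [lipschitz g t | t in [set` I]] <->
  [/\ [lipschitz cx (g t) | t in [set` I]],
      [lipschitz cy (g t) | t in [set` I]]
    & [lipschitz cz (g t) | t in [set` I]]].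
Proof.
have normE (p q : heis R) : `|p - q| =
    Num.max (Num.max `|cx p - cx q| `|cy p - cy q|) `|cz p - cz q| by [].
split=> [/lipschitzP[k kg]|
    [/lipschitzP[k1 kg1] /lipschitzP[k2 kg2] /lipschitzP[k3 kg3]]].
  by split; apply/lipschitzP; exists k => s t sI tI; have := kg s t sI tI;
    rewrite normE !ge_max => /andP[/andP[]].
apply/lipschitzP; exists (Num.max (Num.max k1 k2) k3) => s t sI tI.
rewrite normE !ge_max; apply/andP; split; first (apply/andP; split).
- by apply: le_trans (kg1 s t sI tI) _; rewrite ler_wpM2r// !le_max lexx.
- by apply: le_trans (kg2 s t sI tI) _; rewrite ler_wpM2r// !le_max lexx orbT.
- by apply: le_trans (kg3 s t sI tI) _; rewrite ler_wpM2r// !le_max lexx orbT.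
Qed.

End Components.

(** * Growth of Lipschitz functions whose derivative is bounded almost everywhere *)

Section LipschitzGrowth.
Set Implicit Arguments.
Unset Strict Implicit.
Context {R : realType}.
Local Notation mu := (@lebesgue_measure R).
Implicit Types (f g : R -> R) (a b t : R).

Lemma lebesgue_aeS (P Q : R -> Prop) : (forall t, P t -> Q t) ->
  {ae mu, forall t, P t} -> {ae mu, forall t, Q t}.
Proof.
by move=> PQ; apply: filterS; first exact: (ae_filter_ringOfSetsType mu).
Qed.

Lemma is_derive_within_continuous f (df : R -> R) (A : set R) :
  (forall t, A t -> is_derive t (1 : R) f (df t)) -> {within A, continuous f}.
Proof.
move=> fd; apply/subspace_continuousP => t At.
apply: cvg_within_filter; exact: is_derive_continuous (fd t At).
Qed.

Lemma continuous_FTC2_itvcc f (df : R -> R) a b : a <= b ->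
  (forall t, t \in `[a, b] -> is_derive t (1 : R) f (df t)) ->
  {within `[a, b], continuous df} ->
  (\int[mu]_(t in `[a, b]) (df t)%:E = (f b - f a)%:E)%E.
Proof.
rewrite le_eqVlt => /predU1P[<- _ _|ab fd dfc].
  by rewrite set_itv1 integral_set1 subrr.
rewrite (continuous_FTC2 (F := f)) ?EFinB//.
  split => [t tab||].
  - by have [] := fd t (subset_itv_oo_cc tab).
  - apply: cvg_at_right_filter; apply: is_derive_continuous (fd a _).
    by rewrite in_itv /= lexx ltW.
  - apply: cvg_at_left_filter; apply: is_derive_continuous (fd b _).
    by rewrite in_itv /= lexx ltW.
move=> t tab; rewrite derive1E.
by have [_ ->] := fd t (subset_itv_oo_cc tab).
Qed.

Lemma continuous_antiderivative f (M : R) : continuous f ->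
  exists P : R -> R, forall t, t \in `]-M, M[ -> is_derive t (1 : R) P (f t).
Proof.
move=> fc; pose F (x : R) := (\int[mu]_(t in [set` `[-M, x]]) f t)%R.
exists F => t; rewrite in_itv /= => /andP[Mt tM].
have [] := @continuous_FTC1_closed _ f (-M) t M tM _ Mt (fc t).
  apply: continuous_compact_integrable; first exact: segment_compact.
  exact: continuous_subspaceT.
by move=> dF <-; rewrite derive1E; split.
Qed.

(** Dominated convergence works with sequences, so the derivative is taken along the steps
    [1 / (n + 1)]. *)
Lemma is_derive_cvg_seq f t (d : R) : is_derive t (1 : R) f d ->
  n.+1%:R * (f (t + n.+1%:R^-1) - f t) @[n --> \oo] --> d.
Proof.
case=> fd <-.
have /cvgr_dnbhsP /(_ (fun n => n.+1%:R^-1)) :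
  h^-1 *: ((f \o shift t) (h *: 1) - f t) @[h --> (0 : R)^'] --> 'D_1 f t by [].
have -> : (fun n => n.+1%:R^-1^-1 *: ((f \o shift t) (n.+1%:R^-1 *: 1) - f t)) =
   (fun n => n.+1%:R * (f (t + n.+1%:R^-1) - f t)).
  apply/funext => n; rewrite invrK /= [t + _]addrC.
  by rewrite -[n.+1%:R^-1 *: 1]/(n.+1%:R^-1 * 1) mulr1.
apply; split; first by move=> n; rewrite invr_eq0 pnatr_eq0.
exact: cvg_harmonic.
Qed.

Lemma lipschitz_continuous f (K : R) :
  (forall s t, `|f s - f t| <= K * `|s - t|) -> continuous f.
Proof.
move=> fK t; apply/cvgrPdist_lt => e e0.
have K1 : 0 < `|K| + 1 by rewrite ltr_wpDl.
near=> s; apply: le_lt_trans (fK t s) _.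
apply: (@le_lt_trans _ _ ((`|K| + 1) * `|t - s|)).
  by rewrite ler_wpM2r// ler_wpDr// ler_norm.
rewrite -ltr_pdivlMl// mulrC; near: s.
by apply: cvgr_dist_lt; rewrite ?divr_gt0.
Unshelve. all: by end_near. Qed.

(** The nearest point of [[a, b]] when [a <= b]: composing with it extends a function from [[a, b]]
    to the line without spoiling its Lipschitz bound. *)
Definition clamp a b t : R := Num.max a (Num.min b t).

Lemma clamp_id a b t : t \in `[a, b] -> clamp a b t = t.
Proof. by rewrite in_itv /= /clamp => /andP[at_ tb]; rewrite min_r// max_r. Qed.

Lemma clamp_itv a b t : a <= b -> clamp a b t \in `[a, b].
Proof. by move=> ab; rewrite in_itv /= /clamp le_max lexx ge_max ab ge_min lexx. Qed.

Lemma clamp_dist a b s t : `|clamp a b s - clamp a b t| <= `|s - t|.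
Proof.
have /andP[] : - `|s - t| <= s - t <= `|s - t| by rewrite -ler_norml.
move: (normr_ge0 (s - t)); set e := `|s - t| => e0 st ts.
rewrite ler_norml /clamp.
by case: (leP b s) => ?; case: (leP b t) => ?; case: (leP a b) => ?;
  case: (leP a s) => ?; case: (leP a t) => ?; apply/andP; split; lra.
Qed.

(* The excess r_n of the n-th difference quotient of f over phi tends to 0 in
   L^1 by dominated convergence, while the integral of the quotient, computed
   from a primitive of f, tends to f b - f a. *)
Lemma lipschitz_growth f (phi : R -> R) a b (K : R) : a <= b ->
  (forall s t, s \in `[a, b] -> t \in `[a, b] -> `|f s - f t| <= K * `|s - t|) ->
  measurable_fun `[a, b] phi -> (forall t, t \in `[a, b] -> 0 <= phi t) ->
  {ae mu, forall t, t \in `[a, b] ->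
     exists d : R, is_derive t (1 : R) f d /\ d <= phi t} ->
  ((f b - f a)%:E <= \int[mu]_(t in `[a, b]) (phi t)%:E)%E.
Proof.
move=> ab fK mphi phi0 fphi.
have aab : a \in `[a, b] by rewrite in_itv /= lexx.
have bab : b \in `[a, b] by rewrite in_itv /= lexx ab.
(* The sign of [K] is not given, so the bounds below use its positive part. *)
have K0 : 0 <= Num.max K 0 by rewrite le_max lexx orbT.
pose F t := f (clamp a b t).
have FK s t : `|F s - F t| <= Num.max K 0 * `|s - t|.
  apply: le_trans (fK _ _ (clamp_itv s ab) (clamp_itv t ab)) _.
  apply: (@le_trans _ _ (Num.max K 0 * `|clamp a b s - clamp a b t|)).
    by rewrite ler_wpM2r// le_max lexx.
  by rewrite ler_wpM2l// clamp_dist.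
have Fc : continuous F := lipschitz_continuous FK.
(* The window must contain [[a, b + 1]], since the largest step, at [n = 0], has size 1. *)
pose M : R := `|a| + `|b| + 2.
have inM t : t \in `[a, b + 1] -> t \in `]-M, M[.
  rewrite !in_itv /= => /andP[at_ tb].
  have := ler_norm (- a); have := ler_norm b; rewrite normrN.
  have := normr_ge0 a; have := normr_ge0 b; rewrite /M; lra.
have [P PF] := continuous_antiderivative M Fc.
(* [Q n] is the difference quotient of a primitive of [F], hence a primitive of [q n]; its values at
   [a] and [b] tend to [f a] and [f b]. *)
pose q (n : nat) t := n.+1%:R * (F (t + n.+1%:R^-1) - F t).
pose Q (n : nat) t := n.+1%:R * (P (t + n.+1%:R^-1) - P t).
have n1 (n : nat) : 0 < (n.+1%:R^-1 : R) <= 1.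
  by rewrite invr_gt0 ltr0Sn invf_le1 ?ltr0Sn// ler1n.
have Qq n t : t \in `[a, b] -> is_derive t (1 : R) (Q n) (q n t).
  rewrite in_itv /= => /andP[at_ tb]; have /andP[n0 n1'] := n1 n.
  have tM : t \in `]-M, M[ by apply: inM; rewrite in_itv /= at_; lra.
  have tnM : t + n.+1%:R^-1 \in `]-M, M[.
    apply: inM; move: n0 n1'; rewrite in_itv /=.
    by move: (n.+1%:R^-1) => e e0 e1; apply/andP; split; lra.
  have dP := PF _ tM; have dPn : is_derive t (1 : R)
      (fun s => P (s + n.+1%:R^-1)) (F (t + n.+1%:R^-1)).
    have := derive_compf (g := fun s => s + n.+1%:R^-1) (PF _ tnM).
    by move=> /(_ _ (derive_addf (derive_idf t) (derive_cstf _ t))); rewrite addr0 mulr1.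
  by rewrite /Q /q; derive by ring.
have qc n : continuous (q n).
  apply: (lipschitz_continuous (K := n.+1%:R * (Num.max K 0 * 2))) => s t.
  rewrite /q -mulrBr normrM (ger0_norm (ler0n _ _)) -!mulrA ler_wpM2l//.
  have := FK (s + n.+1%:R^-1) (t + n.+1%:R^-1); have := FK s t.
  rewrite (_ : s + _ - (t + _) = s - t); last by ring.
  move=> Fst Fst'; rewrite mulrA [_ * 2]mulrC -mulrA mulr2n mulrDl mul1r.
  rewrite (_ : _ - _ = (F (s + n.+1%:R^-1) - F (t + n.+1%:R^-1)) - (F s - F t)).
    by apply: le_trans (ler_normB _ _) _; apply: lerD.
  by ring.
have intq n : (\int[mu]_(t in `[a, b]) (q n t)%:E = (Q n b - Q n a)%:E)%E.
  apply: (continuous_FTC2_itvcc (f := Q n) (df := q n)) => //.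
  exact: continuous_subspaceT.
have qK n t : `|q n t| <= Num.max K 0.
  have /andP[n0 _] := n1 n.
  rewrite /q normrM (ger0_norm (ler0n _ _)) -ler_pdivlMl ?ltr0Sn//.
  apply: le_trans (FK _ _) _.
  by rewrite mulrC [t + _]addrC addrK (ger0_norm (ltW n0)).
have Qcvg : (Q n b - Q n a)%:E @[n --> \oo] --> (f b - f a)%:E.
  apply: cvg_EFin; first by apply: nearW.
  have Pab t : t \in `[a, b] -> Q n t @[n --> \oo] --> f t.
    move=> tab; rewrite -[f t](congr1 f (clamp_id tab)).
    apply: is_derive_cvg_seq; apply: PF; apply: inM.
    by move: tab; rewrite !in_itv /= => /andP[-> tb]; lra.
  by apply: cvgB; apply: Pab.
have mab : measurable (`[a, b] : set R) by exact: measurable_itv.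
have mq n : measurable_fun `[a, b] (q n).
  apply: measurable_funTS; exact: continuous_measurable_fun.
pose r (n : nat) t := Num.max 0 (q n t - phi t).
have mr n : measurable_fun `[a, b] (r n).
  by apply: measurable_maxr => //; apply: measurable_funB.
have r0 n t : 0 <= r n t by rewrite le_max lexx.
have rK n t : t \in `[a, b] -> r n t <= Num.max K 0.
  move=> /phi0 pt; rewrite /r ge_max K0 /= lerBlDr.
  by apply: le_trans (ler_norm _) _; apply: le_trans (qK n t) _; rewrite lerDl.
have rcvg : (\int[mu]_(t in `[a, b]) (r n t)%:E)%E @[n --> \oo] --> 0%E.
  have intK : mu.-integrable `[a, b] (EFin \o (fun=> Num.max K 0)).
    apply: continuous_compact_integrable; first exact: segment_compact.
    by apply: continuous_subspaceT => ?; exact: cvg_cst.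
  have [] := @dominated_convergence _ _ _ mu `[a, b]%classic mab
     (fun n t => (r n t)%:E) (cst 0%E) (EFin \o (fun=> Num.max K 0)).
  - by move=> n; apply/(measurable_EFinP _ (r n)); exact: mr.
  - exact: measurable_cst.
  - apply: lebesgue_aeS fphi => t /= ft tab; have [d [fd dphi]] := ft tab.
    apply: cvg_EFin; first by apply: nearW.
    (* At [t = b] the extension is constant to the right, so [q n b] is 0 and need not approach [d];
       the excess still vanishes because [phi] is nonnegative. *)
    have [tb|tb] : t < b \/ t = b.
      by move: tab; rewrite in_itv /= => /andP[_]; rewrite le_eqVlt => /predU1P[]; [right|left].
      have {}fd : q n t @[n --> \oo] --> d.
        apply: cvg_trans (is_derive_cvg_seq fd); apply: near_eq_cvg.
        near=> n; rewrite /q /F !clamp_id//; move: tab; rewrite !in_itv /=.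
        have nb : n.+1%:R^-1 < b - t.
          near: n; apply: cvgr_lt cvg_harmonic _ _; by rewrite subr_gt0.
        have /andP[n0 _] := n1 n.
        by move: (n.+1%:R^-1) nb n0 => e eb e0 /andP[at_ _]; apply/andP; split; lra.
      apply/cvgrPdist_lt => e e0; near=> n.
      have : `|d - q n t| < e by near: n; move/cvgrPdist_lt: fd; apply.
      rewrite ltr_norml => /andP[? ?].
      rewrite sub0r normrN ger0_norm ?r0// /r gt_max e0 /=.
      by lra.
    apply: cvg_near_cst; apply: nearW => n.
    have /andP[n0 _] := n1 n.
    rewrite /= /r /q /F [clamp a b (t + _)](_ : _ = t).
      by rewrite clamp_id// subrr mulr0 sub0r max_l// oppr_le0 phi0.
    rewrite /clamp tb min_l ?max_r// ?lerDl ltW//.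
  - exact: intK.
  - by apply: aeW => t n tab /=; rewrite lee_fin ger0_norm//; apply: rK.
  - move=> _ _; rewrite integral0; exact.
have mphie : measurable_fun `[a, b] (EFin \o phi) by exact/measurable_EFinP.
(* An infinite right-hand side leaves nothing to prove; otherwise [phi] is integrable and the
   integrals of [phi] and [r n] can be added. *)
have [->|phify] := eqVneq (\int[mu]_(t in `[a, b]) (phi t)%:E)%E +oo%E.
  exact: leey.
have iphi : mu.-integrable `[a, b] (EFin \o phi).
  apply/integrableP; split=> //.
  suff -> : (\int[mu]_(t in `[a, b]) `|(EFin \o phi) t| =
      \int[mu]_(t in `[a, b]) (phi t)%:E)%E by rewrite ltey.
  by apply: eq_integral => t; rewrite inE /= => tab; rewrite ger0_norm ?phi0.
have ir n : mu.-integrable `[a, b] (EFin \o r n).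
  apply: measurable_bounded_integrable => //.
    by apply: compact_finite_measure; exact: segment_compact.
    exact: mr.
  exists (Num.max K 0); split; first exact: num_real.
  by move=> l Kl t tab /=; rewrite ger0_norm//; apply: le_trans (ltW Kl); apply: rK.
have qle n : ((Q n b - Q n a)%:E <=
    \int[mu]_(t in `[a, b]) (phi t)%:E + \int[mu]_(t in `[a, b]) (r n t)%:E)%E.
  have -> : (\int[mu]_(t in `[a, b]) (phi t)%:E + \int[mu]_(t in `[a, b]) (r n t)%:E =
      \int[mu]_(t in `[a, b]) ((phi t)%:E + (r n t)%:E))%E.
    by rewrite integralD//; exact: ir.
  rewrite -intq; apply: le_integral => //.
  - apply: continuous_compact_integrable; first exact: segment_compact.
    exact: continuous_subspaceT.
  - by apply: integrableD => //; exact: ir.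
  - move=> t _; rewrite -EFinD lee_fin /r -lerBlDl le_max lexx orbT//.
have : (\int[mu]_(t in `[a, b]) (phi t)%:E + \int[mu]_(t in `[a, b]) (r n t)%:E)%E
    @[n --> \oo] --> (\int[mu]_(t in `[a, b]) (phi t)%:E)%E.
  rewrite -[X in _ --> X]adde0; apply: cvgeD; [|exact: cvg_cst|exact: rcvg].
  by rewrite fin_num_adde_defl.
move=> rc; apply: (lee_cvg_to Qcvg rc); exact: nearW.
Unshelve. all: by end_near. Qed.


End LipschitzGrowth.

(** * Rotations and left translations as isometries *)

Section Motions.
Context {R : realType}.
Set Implicit Arguments.
Unset Strict Implicit.
Local Notation mu := (@lebesgue_measure R).
Implicit Types (c s : R) (p q : heis R) (u : R * R) (g : R -> heis R).

Definition rotation c s u : R * R := (c * u.1 - s * u.2, s * u.1 + c * u.2).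

(* [motion c s p] is the rotation of matrix (c, -s; s, c) around the z-axis
   followed by the left translation by [p] in the Heisenberg group. *)
Definition motion c s p q : heis R :=
  let v := rotation c s (cx q, cy q) in
  (cx p + v.1, cy p + v.2, cz p + cz q + (cx p * v.2 - cy p * v.1) / 2).

Lemma hnorm_rotation c s u : c ^+ 2 + s ^+ 2 = 1 -> hnorm (rotation c s u) = hnorm u.
Proof.
move=> cs; rewrite /hnorm; congr Num.sqrt => /=.
rewrite -[RHS]mul1r -cs; ring.
Qed.

(** The inverse is again a motion: the opposite rotation, with the inverse of [p] turned back as
    translation part. *)
Lemma motionK c s p : c ^+ 2 + s ^+ 2 = 1 ->
  cancel (motion c s p)
    (motion c (- s) (- (c * cx p + s * cy p), s * cx p - c * cy p, - cz p)).
Proof.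
move=> cs [[x y] z]; rewrite /motion /rotation /cx /cy /cz /=.
have s2 : s ^+ 2 = 1 - c ^+ 2 by rewrite -cs; ring.
by congr (_, _, _); ring: s2.
Qed.

Lemma motion_bij c s p : c ^+ 2 + s ^+ 2 = 1 -> bijective (motion c s p).
Proof.
move=> cs; pose p' : heis R := (- (c * cx p + s * cy p), s * cx p - c * cy p, - cz p).
exists (motion c (- s) p'); first exact: motionK.
have cs' : c ^+ 2 + (- s) ^+ 2 = 1 by rewrite sqrrN.
(* Inverting the inverse motion gives back the parameters [c], [s], [p], so the same lemma yields
   the second cancellation. *)
have := motionK p' cs'; rewrite opprK; congr (cancel _ (motion c s _)).
have s2 : s ^+ 2 = 1 - c ^+ 2 by rewrite -cs; ring.
case: p @p' => [[x y] z]; rewrite /cx /cy /cz /=.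
by congr (_, _, _); ring: s2.
Qed.

(** The frame is invariant under left translations, which therefore keep the components of the
    velocity; the rotation turns them and preserves swept area. *)
Lemma has_velocity_motion c s p g t u : c ^+ 2 + s ^+ 2 = 1 ->
  has_velocity g t u -> has_velocity (fun r => motion c s p (g r)) t (rotation c s u).
Proof.
move=> cs /has_velocityP[dx dy dz]; apply/has_velocityP; split.
- rewrite [X in is_derive _ _ X](_ : _ =
    fun r => cx p + (c * cx (g r) + - (s * cy (g r))))//.
  by derive by (rewrite /=; ring).
- rewrite [X in is_derive _ _ X](_ : _ =
    fun r => cy p + (s * cx (g r) + c * cy (g r)))//.
  by derive by (rewrite /=; ring).
- rewrite [X in is_derive _ _ X](_ : _ =
    fun r => (cz p + cz (g r)) + (cx p * (s * cx (g r) + c * cy (g r))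
      + - (cy p * (c * cx (g r) + - (s * cy (g r))))) * 2^-1)//.
  have s2 : s ^+ 2 = 1 - c ^+ 2 by rewrite -cs; ring.
  by derive by (rewrite /motion /= /cx /cy /=; ring: s2).
Qed.

Lemma horizontal_motion (I : interval R) c s p g (u : R -> R * R) :
  c ^+ 2 + s ^+ 2 = 1 -> horizontal I g u ->
  horizontal I (fun t => motion c s p (g t)) (fun t => rotation c s (u t)).
Proof.
move=> cs [/lipschitz_heisP[/lipschitzP[k1 Lx] /lipschitzP[k2 Ly] /lipschitzP[k3 Lz]]
  m1 m2 [M uM] gu].
have Lrot (a b : R) : exists k, forall t r, t \in I -> r \in I ->
    `|(a * cx (g t) + b * cy (g t)) - (a * cx (g r) + b * cy (g r))| <= k * `|t - r|.
  exists (`|a| * k1 + `|b| * k2) => t r tI rI.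
  rewrite (_ : _ - _ = a * (cx (g t) - cx (g r)) + b * (cy (g t) - cy (g r))); last by ring.
  rewrite mulrDl -!mulrA (le_trans (ler_normD _ _))// !normrM.
  by apply: lerD; rewrite ler_wpM2l ?Lx ?Ly.
split.
- apply/lipschitz_heisP; split; apply/lipschitzP.
  + have [k kP] := Lrot c (- s); exists k => t r tI rI.
    by rewrite [X in `|X|](_ : _ = c * cx (g t) + - s * cy (g t) -
      (c * cx (g r) + - s * cy (g r))) ?kP// /motion /cx /=; ring.
  + have [k kP] := Lrot s c; exists k => t r tI rI.
    by rewrite [X in `|X|](_ : _ = s * cx (g t) + c * cy (g t) -
      (s * cx (g r) + c * cy (g r))) ?kP// /motion /cy /=; ring.
  + have [k kP] := Lrot ((cx p * s - cy p * c) / 2) ((cx p * c + cy p * s) / 2).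
    exists (k3 + k) => t r tI rI; rewrite mulrDl.
    apply: le_trans (lerD (Lz t r tI rI) (kP t r tI rI)).
    apply: le_trans (ler_normD _ _).
    by rewrite le_eqVlt; apply/orP; left; apply/eqP; congr `|_|; rewrite /motion /cx /cy /cz /=; ring.
- by apply: measurable_funB; apply: measurable_funM => //; exact: measurable_cst.
- by apply: measurable_funD; apply: measurable_funM => //; exact: measurable_cst.
- by exists M; apply: lebesgue_aeS uM => t; rewrite hnorm_rotation.
- by apply: lebesgue_aeS gu => t gu tI; apply: has_velocity_motion => //; apply: gu.
Qed.

(** Competitors from [A] to [B] are carried to competitors of the same length. The reverse
    inequality comes from the inverse motion. *)
Lemma dH_motion_le c s p (A B : heis R) : c ^+ 2 + s ^+ 2 = 1 ->
  (dH (motion c s p A) (motion c s p B) <= dH A B)%E.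
Proof.
move=> cs; apply: le_ereal_inf_tmp => l [a [b [g [u [ab gu gA gB ->]]]]].
apply: ereal_inf_lbound; exists a, b, (fun t => motion c s p (g t)), (fun t => rotation c s (u t)).
split=> //; [exact: horizontal_motion | by rewrite gA | by rewrite gB |].
by apply: eq_integral => t _; rewrite hnorm_rotation.
Qed.

Lemma dH_motion c s p (A B : heis R) : c ^+ 2 + s ^+ 2 = 1 ->
  dH (motion c s p A) (motion c s p B) = dH A B.
Proof.
move=> cs; apply/eqP; rewrite eq_le dH_motion_le//=.
by rewrite -{1}[A](motionK p cs) -{1}[B](motionK p cs) dH_motion_le ?sqrrN.
Qed.

Lemma motion_isometry c s p : c ^+ 2 + s ^+ 2 = 1 -> heis_isometry (motion c s p).
Proof. by move=> cs; split; [exact: motion_bij | move=> A B; exact: dH_motion]. Qed.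

End Motions.

(** * Velocity and characteristic deviation of arc-length curves *)

Section ArclengthCurves.
Context {R : realType}.
Set Implicit Arguments.
Unset Strict Implicit.
Variables (I : interval R).
Hypothesis I_open : forall t, t \in I -> \forall s \near t, s \in I.

(** Taking a coordinate commutes with iterated derivatives at points of [I]. The induction carries
    the equality together with the derivative, and openness of [I] makes the equality hold near each
    point, as differentiating it requires. *)
Lemma smooth_on_component (pr : heis R -> R) (g : R -> heis R) :
  (forall (f : R -> heis R) (t : R) v, is_derive t (1 : R) f v ->
     is_derive t (1 : R) (fun s => pr (f s)) (pr v)) ->
  smooth_on I g ->
  forall n t, t \in I ->
    is_derive t (1 : R) (derive1n n (pr \o g)) (derive1n n.+1 (pr \o g) t).
Proof.
move=> pr_derive sg.
have compE n t : t \in I -> derive1n n (pr \o g) t = pr (derive1n n g t) /\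
    is_derive t (1 : R) (derive1n n (pr \o g)) (pr (derive1n n.+1 g t)).
  elim: n t => [|n IH] t tI.
    split=> //; apply: pr_derive; rewrite derive1n1 derive1E.
    exact/derivableP/(sg 0%N).
  split; first by rewrite derive1nS derive1E; have [_ [_ ->]] := IH t tI.
  apply: (is_derive_near (f := fun s => pr (derive1n n.+1 g s))).
    near=> s; have sI : s \in I by near: s; exact: I_open.
    by rewrite [in RHS]derive1nS derive1E; have [_ [_ ->]] := IH s sI.
  apply: pr_derive; rewrite [in X in is_derive _ _ _ X]derive1nS derive1E.
  exact/derivableP/(sg n.+1).
move=> n t tI; have [_ [dn _]] := compE n t tI.
by rewrite [in X in is_derive _ _ _ X]derive1nS derive1E; exact: derivableP.
Unshelve. all: by end_near. Qed.

Variable g : R -> heis R.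
Hypothesis g_arc : smooth_horizontal_arclength I g.

Let x := cx \o g.
Let y := cy \o g.

Definition velocity t : R * R := (derive1 x t, derive1 y t).

Lemma derive_x n t : t \in I -> is_derive t (1 : R) (derive1n n x) (derive1n n.+1 x t).
Proof.
by apply: smooth_on_component; [move=> f s v /is_derive_heisP[] | case: g_arc].
Qed.

Lemma derive_y n t : t \in I -> is_derive t (1 : R) (derive1n n y) (derive1n n.+1 y t).
Proof.
by apply: smooth_on_component; [move=> f s v /is_derive_heisP[] | case: g_arc].
Qed.

Lemma has_velocity_velocity t : t \in I -> has_velocity g t (velocity t).
Proof.
case: g_arc => _ gv /gv[[u1 u2] [gu _]].
suff -> : velocity t = (u1, u2) by [].
have /has_velocityP[/= [_ <-] [_ <-] _] := gu.
by rewrite /velocity !derive1E.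
Qed.

Lemma velocity_norm t : t \in I -> (velocity t).1 ^+ 2 + (velocity t).2 ^+ 2 = 1.
Proof.
case: g_arc => _ gv /gv[[u1 u2] [gu u1E]].
have /has_velocityP[/= [_ d1] [_ d2] _] := gu.
rewrite /velocity /= !derive1E d1 d2.
move: u1E; rewrite /hnorm /= => /(congr1 (fun r => r ^+ 2)).
by rewrite expr1n sqr_sqrtr// addr_ge0// sqr_ge0.
Qed.

Lemma hnorm_velocity t : t \in I -> hnorm (velocity t) = 1.
Proof. by move=> tI; rewrite /hnorm velocity_norm// sqrtr1. Qed.

(** Frenet equations: a velocity of constant norm is orthogonal to its derivative, which is thus a
    multiple of the velocity turned by a quarter turn; the factor is the determinant of the two,
    that is, the characteristic deviation. *)
Lemma velocity_curvature t : t \in I ->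
  is_derive t (1 : R) (fun s => (velocity s).1)
    (- (char_deviation g t * (velocity t).2)) /\
  is_derive t (1 : R) (fun s => (velocity s).2)
    (char_deviation g t * (velocity t).1).
Proof.
move=> tI.
have d1 : is_derive t (1 : R) (fun s => (velocity s).1) (derive1n 2 x t).
  exact: (derive_x 1 tI).
have d2 : is_derive t (1 : R) (fun s => (velocity s).2) (derive1n 2 y t).
  exact: (derive_y 1 tI).
have n1 := velocity_norm tI.
have : is_derive t (1 : R) (fun s => (velocity s).1 ^+ 2 + (velocity s).2 ^+ 2) 0.
  apply: is_derive_near (derive_cstf 1 t).
  by near=> s; rewrite velocity_norm//; near: s; exact: I_open.
have /is_derive_inj /[apply] : is_derive t (1 : R)
   (fun s => (velocity s).1 ^+ 2 + (velocity s).2 ^+ 2)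
   (2 * ((velocity t).1 * derive1n 2 x t + (velocity t).2 * derive1n 2 y t)).
  apply: is_derive_eq (derive_addf (derive_expf 2 d1) (derive_expf 2 d2)) _.
  by move: (velocity t).1 (velocity t).2 (derive1n 2 x t) (derive1n 2 y t) => *; rewrite /=; ring.
rewrite -[char_deviation g t]/((velocity t).1 * derive1n 2 y t - (velocity t).2 * derive1n 2 x t).
move: n1 d1 d2.
move: (velocity t).1 (velocity t).2 (derive1n 2 x t) (derive1n 2 y t) => u1 u2 a b.
move=> n1 d1 d2 uu.
split.
  suff <- : a = - ((u1 * b - u2 * a) * u2) by [].
  have : u1 * a = - (u2 * b) by move: uu; lra.
  move=> u1a; rewrite -[LHS]mul1r -n1 mulrDl expr2 -mulrA u1a; ring.
  suff <- : b = (u1 * b - u2 * a) * u1 by [].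
  have : u2 * b = - (u1 * a) by move: uu; lra.
  move=> u2b; rewrite -[LHS]mul1r -n1 mulrDl [u2 ^+ 2]expr2 -[u2 * u2 * b]mulrA u2b; ring.
Unshelve. all: by end_near. Qed.

(** The derivative of the characteristic deviation: the products of second derivatives cancel. *)
Definition char_deviation' t : R :=
  derive1n 1 x t * derive1n 3 y t - derive1n 1 y t * derive1n 3 x t.

Lemma derive_char_deviation t : t \in I ->
  is_derive t (1 : R) (char_deviation g) (char_deviation' t).
Proof.
move=> tI; have := derive_addf (derive_mulf (derive_x 1 tI) (derive_y 2 tI))
  (derive_oppf (derive_mulf (derive_y 1 tI) (derive_x 2 tI))).
move=> /is_derive_eq; apply; rewrite /char_deviation'.
move: (derive1n 1 x t) (derive1n 2 x t) (derive1n 3 x t) => x1 x2 x3.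
by move: (derive1n 1 y t) (derive1n 2 y t) (derive1n 3 y t) => y1 y2 y3; ring.
Qed.

Lemma char_deviation'_continuous t : t \in I -> {for t, continuous char_deviation'}.
Proof.
move=> tI; have := derive_addf (derive_mulf (derive_x 1 tI) (derive_y 3 tI))
  (derive_oppf (derive_mulf (derive_y 1 tI) (derive_x 3 tI))).
exact: is_derive_continuous.
Qed.

End ArclengthCurves.

(** * Congruence of curves with equal characteristic deviation *)

Section Congruence.
Context {R : realType}.
Set Implicit Arguments.
Unset Strict Implicit.
Implicit Types (I : interval R) (f : R -> R) (g : R -> heis R).

Lemma lipschitz_of_derive I f (df : R -> R) (K : R) :
  (forall t, t \in I -> is_derive t (1 : R) f (df t)) ->
  (forall t, t \in I -> `|df t| <= K) ->
  forall s t, s \in I -> t \in I -> `|f s - f t| <= K * `|s - t|.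
Proof.
move=> fd dfK s t; wlog st : s t / s <= t => [hw sI tI|sI tI].
  by case: (leP s t) => [|/ltW] st; [|rewrite distrC [`|s - t|]distrC]; apply: hw.
have stI r : r \in `[s, t] -> r \in I.
  rewrite in_itv /=; exact: (@interval_is_interval _ I s t).
rewrite distrC [`|s - t|]distrC.
have [r rI ->] := MVT_segment st (fun r rst => fd r (stI r (subset_itv_oo_cc rst)))
  (is_derive_within_continuous (fun r rst => fd r (stI r rst))).
by rewrite normrM ler_wpM2r// dfK// stI.
Qed.

Lemma derive0_constant I f : (forall t, t \in I -> is_derive t (1 : R) f 0) ->
  forall s t, s \in I -> t \in I -> f s = f t.
Proof.
move=> fd s t sI tI; apply/eqP; rewrite -subr_eq0 -normr_le0.
by rewrite -[leRHS](mul0r `|s - t|) (lipschitz_of_derive fd)// => ? _; rewrite normr0.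
Qed.

(** The plane coordinates agree first; the derivative of the height depends only on them and on [u],
    so the heights agree next. *)
Lemma has_velocity_unique I g1 g2 (u : R -> R * R) t0 :
  (forall t, t \in I -> has_velocity g1 t (u t)) ->
  (forall t, t \in I -> has_velocity g2 t (u t)) ->
  t0 \in I -> g1 t0 = g2 t0 -> forall t, t \in I -> g1 t = g2 t.
Proof.
move=> d1 d2 t0I g0.
have eq0 (f1 f2 : R -> R) : f1 t0 = f2 t0 -> (forall t, t \in I ->
    exists d : R, is_derive t (1 : R) f1 d /\ is_derive t (1 : R) f2 d) ->
    forall t, t \in I -> f1 t = f2 t.
  move=> f0 fd t tI; apply/eqP; rewrite -subr_eq0; apply/eqP.
  rewrite (derive0_constant (f := fun s => f1 s - f2 s) _ tI t0I) ?f0 ?subrr//.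
  by move=> s sI; have [d [? ?]] := fd s sI; derive by rewrite subrr.
have eqx : forall t, t \in I -> cx (g1 t) = cx (g2 t).
  apply: eq0; first by rewrite g0.
  move=> t tI; exists (u t).1.
  by have /has_velocityP[] := d1 t tI; have /has_velocityP[] := d2 t tI.
have eqy : forall t, t \in I -> cy (g1 t) = cy (g2 t).
  apply: eq0; first by rewrite g0.
  move=> t tI; exists (u t).2.
  by have /has_velocityP[] := d1 t tI; have /has_velocityP[] := d2 t tI.
have eqz : forall t, t \in I -> cz (g1 t) = cz (g2 t).
  apply: eq0; first by rewrite g0.
  move=> t tI; exists ((cx (g1 t) * (u t).2 - cy (g1 t) * (u t).1) / 2).
  have /has_velocityP[_ _ dz1] := d1 t tI; have /has_velocityP[_ _ dz2] := d2 t tI.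
  by rewrite {2}eqx// {2}eqy.
move=> t tI; move: (eqx t tI) (eqy t tI) (eqz t tI).
by case: (g1 t) (g2 t) => [[? ?] ?] [[? ?] ?]; rewrite /cx /cy /cz /= => -> -> ->.
Qed.

(** The translation is solved for: its plane part first, then its height. *)
Lemma motion_transitive (c s : R) (q r : heis R) : exists p, motion c s p q = r.
Proof.
case: q r => [[x y] z] [[x' y'] z'].
pose v := rotation c s (x, y).
exists (x' - v.1, y' - v.2, z' - z - ((x' - v.1) * v.2 - (y' - v.2) * v.1) / 2).
by rewrite /motion /cx /cy /cz /= -/v; congr (_, _, _); ring.
Qed.

Lemma congruence I (zeta1 zeta2 : R -> heis R) t0 :
  (forall t, t \in I -> \forall s \near t, s \in I) -> t0 \in I ->
  smooth_horizontal_arclength I zeta1 -> smooth_horizontal_arclength I zeta2 ->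
  (forall t, t \in I -> char_deviation zeta1 t = char_deviation zeta2 t) ->
  exists c s p, c ^+ 2 + s ^+ 2 = 1 /\
    forall t, t \in I -> zeta2 t = motion c s p (zeta1 t).
Proof.
move=> I_open t0I arc1 arc2 h12.
(* [c] and [s] are the cosine and sine of the angle from the velocity of [zeta1] to that of
   [zeta2]. *)
pose c t := (velocity zeta1 t).1 * (velocity zeta2 t).1 +
            (velocity zeta1 t).2 * (velocity zeta2 t).2.
pose s t := (velocity zeta1 t).1 * (velocity zeta2 t).2 -
            (velocity zeta1 t).2 * (velocity zeta2 t).1.
have c0 t : t \in I -> c t = c t0.
  move=> tI; apply: (derive0_constant _ tI t0I) => r rI.
  have [d1 d2] := velocity_curvature I_open arc1 rI.
  have [e1 e2] := velocity_curvature I_open arc2 rI.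
  apply: is_derive_eq (derive_addf (derive_mulf d1 e1) (derive_mulf d2 e2)) _.
  by rewrite h12//; ring.
have s0 t : t \in I -> s t = s t0.
  move=> tI; apply: (derive0_constant _ tI t0I) => r rI.
  have [d1 d2] := velocity_curvature I_open arc1 rI.
  have [e1 e2] := velocity_curvature I_open arc2 rI.
  apply: is_derive_eq (derive_addf (derive_mulf d1 e2) (derive_oppf (derive_mulf d2 e1))) _.
  by rewrite h12//; ring.
have n1 t : t \in I -> (velocity zeta1 t).1 ^+ 2 = 1 - (velocity zeta1 t).2 ^+ 2.
  by move=> tI; rewrite -(velocity_norm arc1 tI) addrK.
have n2 t : t \in I -> (velocity zeta2 t).1 ^+ 2 = 1 - (velocity zeta2 t).2 ^+ 2.
  by move=> tI; rewrite -(velocity_norm arc2 tI) addrK.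
have cs : c t0 ^+ 2 + s t0 ^+ 2 = 1.
  by move: (n1 _ t0I) (n2 _ t0I) => n1' n2'; rewrite /c /s; ring: n1' n2'.
have [p pE] := motion_transitive (c t0) (s t0) (zeta1 t0) (zeta2 t0).
exists (c t0), (s t0), p; split=> //.
apply: (has_velocity_unique (u := velocity zeta2) _ _ t0I) => // t tI.
  exact: has_velocity_velocity arc2 _ tI.
have := has_velocity_motion p cs (has_velocity_velocity arc1 tI).
congr (has_velocity _ _ _); rewrite -(c0 _ tI) -(s0 _ tI) /rotation /c /s.
rewrite [RHS]surjective_pairing; move: (n1 _ tI).
move: (velocity zeta1 t).1 (velocity zeta1 t).2 (velocity zeta2 t).1 (velocity zeta2 t).2.
by move=> a b a' b' n1'; congr (_, _); ring: n1'.
Qed.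

Lemma near_mem_itvoo (a b : R) t : t \in `]a, b[ -> \forall s \near t, s \in `]a, b[.
Proof. exact: near_in_itvoo. Qed.

End Congruence.

(** * Length estimates for horizontal curves *)

Section Lengths.
Context {R : realType}.
Set Implicit Arguments.
Unset Strict Implicit.
Local Notation mu := (@lebesgue_measure R).
Implicit Types (I : interval R) (g : R -> heis R) (u : R -> R * R).

Lemma hnorm_ge0 (w : R * R) : 0 <= hnorm w.
Proof. exact: sqrtr_ge0. Qed.

Lemma fst_le_hnorm (w : R * R) : `|w.1| <= hnorm w.
Proof. by rewrite -sqrtr_sqr ler_wsqrtr// lerDl sqr_ge0. Qed.

Lemma snd_le_hnorm (w : R * R) : `|w.2| <= hnorm w.
Proof. by rewrite -sqrtr_sqr ler_wsqrtr// lerDr sqr_ge0. Qed.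

(** Cauchy-Schwarz, by Lagrange's identity. It bounds the growth of a function with horizontal
    gradient [(a, b)] by length. *)
Lemma hnorm_dual (a b : R) (w : R * R) : a ^+ 2 + b ^+ 2 <= 1 ->
  a * w.1 + b * w.2 <= hnorm w.
Proof.
move=> ab; apply: le_trans (ler_norm _) _; rewrite -sqrtr_sqr ler_wsqrtr//.
have w0 : 0 <= w.1 ^+ 2 + w.2 ^+ 2 by rewrite addr_ge0 ?sqr_ge0.
apply: (@le_trans _ _ ((a ^+ 2 + b ^+ 2) * (w.1 ^+ 2 + w.2 ^+ 2))).
  rewrite -subr_ge0 (_ : _ - _ = (a * w.2 - b * w.1) ^+ 2) ?sqr_ge0//.
  by move: w.1 w.2 => *; ring.
by rewrite ler_piMl.
Qed.

Lemma measurable_hnorm (D : set R) u : measurable_fun D (fun t => (u t).1) ->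
  measurable_fun D (fun t => (u t).2) -> measurable_fun D (fun t => hnorm (u t)).
Proof.
move=> m1 m2; apply: (measurableT_comp (f := @Num.sqrt R)).
  by apply: continuous_measurable_fun; exact: sqrt_continuous.
by apply: measurable_funD; apply: measurable_funX.
Qed.

(** The speed bound makes [x] and [y] Lipschitz. The derivative of [z] involves [x] and [y]
    themselves, which stay bounded because [D] bounds the extent of [I]. *)
Lemma horizontal_of_velocity I g u (M D t0 : R) :
  (forall t, t \in I -> has_velocity g t (u t)) ->
  (forall t, t \in I -> hnorm (u t) <= M) ->
  measurable_fun [set` I] (fun t => (u t).1) ->
  measurable_fun [set` I] (fun t => (u t).2) ->
  t0 \in I -> (forall t, t \in I -> `|t - t0| <= D) ->
  horizontal I g u.
Proof.
move=> gu uM m1 m2 t0I tD.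
have dx t (tI : t \in I) : is_derive t (1 : R) (fun s => cx (g s)) (u t).1.
  by have /has_velocityP[] := gu t tI.
have dy t (tI : t \in I) : is_derive t (1 : R) (fun s => cy (g s)) (u t).2.
  by have /has_velocityP[] := gu t tI.
have dz t (tI : t \in I) : is_derive t (1 : R) (fun s => cz (g s))
    ((cx (g t) * (u t).2 - cy (g t) * (u t).1) / 2).
  by have /has_velocityP[] := gu t tI.
have M0 : 0 <= M by apply: le_trans (hnorm_ge0 _) (uM t0 t0I).
have uM1 t : t \in I -> `|(u t).1| <= M by move=> /uM; apply: le_trans; exact: fst_le_hnorm.
have uM2 t : t \in I -> `|(u t).2| <= M by move=> /uM; apply: le_trans; exact: snd_le_hnorm.
have Lx := lipschitz_of_derive dx uM1; have Ly := lipschitz_of_derive dy uM2.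
have bound (f : R -> R) : (forall s t, s \in I -> t \in I -> `|f s - f t| <= M * `|s - t|) ->
    forall t, t \in I -> `|f t| <= `|f t0| + M * D.
  move=> Lf t tI; rewrite -[f t](subrK (f t0)) addrC.
  by apply: le_trans (ler_normD _ _) _; rewrite lerD2l (le_trans (Lf _ _ tI t0I))// ler_wpM2l// tD.
split=> //.
- apply/lipschitz_heisP; split; apply/lipschitzP; [by exists M | by exists M |].
  exists (((`|cx (g t0)| + M * D) * M + (`|cy (g t0)| + M * D) * M) / 2).
  apply: lipschitz_of_derive dz _ => t tI.
  rewrite normrM [`|2^-1|]ger0_norm ?invr_ge0// ler_wpM2r ?invr_ge0//.
  apply: le_trans (ler_normB _ _) _; rewrite !normrM.
  by apply: lerD; apply: ler_pM; rewrite ?normr_ge0 ?uM1 ?uM2 ?(bound (fun s => cx (g s))) ?(bound (fun s => cy (g s))).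
- by exists M; apply: aeW => t; exact: uM.
- by apply: aeW => t; exact: gu.
Qed.

Lemma hlength_unit u (a b : R) : a <= b ->
  measurable_fun `[a, b] (fun t => (u t).1) ->
  measurable_fun `[a, b] (fun t => (u t).2) ->
  {ae mu, forall t, t \in `[a, b] -> hnorm (u t) = 1} ->
  hlength `[a, b] u = (b - a)%:E.
Proof.
move=> ab m1 m2 u1; rewrite /hlength.
rewrite (ae_eq_integral (cst 1%E))//.
- rewrite integral_cst//= mul1e lebesgue_measure_itv/=.
  by move: ab; rewrite le_eqVlt => /predU1P[->|ab]; rewrite ?ltxx ?subrr// lte_fin ab.
- by apply/(measurable_EFinP _ (fun t => hnorm (u t))); apply: measurable_hnorm.
- by apply: lebesgue_aeS u1 => t u1 tab; rewrite /= u1.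
Qed.

Lemma dH_le_horizontal (a b : R) g u : a <= b -> horizontal `[a, b] g u ->
  (dH (g a) (g b) <= hlength `[a, b] u)%E.
Proof. by move=> ab gu; apply: ereal_inf_lbound; exists a, b, g, u. Qed.

Lemma within_continuous_measurable (f : R -> R) (a b : R) :
  (forall t, t \in `[a, b] -> {for t, continuous f}) -> measurable_fun `[a, b] f.
Proof.
move=> fc; apply: subspace_continuous_measurable_fun => //.
by apply/subspace_continuousP => t tab; apply: cvg_within_filter; exact: fc.
Qed.

End Lengths.

(** * Lower bounds for the distance by calibration *)

Section Calibration.
Context {R : realType}.
Set Implicit Arguments.
Unset Strict Implicit.
Local Notation mu := (@lebesgue_measure R).
Implicit Types (g : R -> heis R) (u : R -> R * R).

(* Its horizontal gradient at (x, y, z) is (G' x, k x), a unit vector as long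
   as G' x = sqrt (1 - (k x)^2). *)
Definition calibration (G : R -> R) (k : R) (q : heis R) : R :=
  G (cx q) + k * (cz q + cx q * cy q / 2).

(** The sign of the increment decides whether [lipschitz_growth] is applied to [f] or to [- f]. *)
Lemma horizontal_growth (f : R -> R) (a b K : R) u : a <= b ->
  (forall s t, s \in `[a, b] -> t \in `[a, b] -> `|f s - f t| <= K * `|s - t|) ->
  measurable_fun `[a, b] (fun t => (u t).1) ->
  measurable_fun `[a, b] (fun t => (u t).2) ->
  {ae mu, forall t, t \in `[a, b] ->
     exists d : R, is_derive t (1 : R) f d /\ `|d| <= hnorm (u t)} ->
  (`|f b - f a|%:E <= hlength `[a, b] u)%E.
Proof.
move=> ab Lf m1 m2 df.
have mu' : measurable_fun `[a, b] (fun t => hnorm (u t)) by exact: measurable_hnorm.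
rewrite /hlength; case: (ger0P (f b - f a)) => _.
  apply: (lipschitz_growth ab Lf mu') => //; first by move=> *; exact: hnorm_ge0.
  apply: lebesgue_aeS df => t dft /dft[d [fd dn]]; exists d; split=> //.
  exact: le_trans (ler_norm _) dn.
have -> : - (f b - f a) = (- f b) - (- f a) by ring.
apply: (lipschitz_growth (f := fun t => - f t) (K := K) ab) => //.
- by move=> s t sI tI; rewrite -opprD normrN; apply: Lf.
- by move=> *; exact: hnorm_ge0.
apply: lebesgue_aeS df => t dft /dft[d [fd dn]]; exists (- d); split.
  exact: derive_oppf.
by apply: le_trans (ler_norm _) _; rewrite normrN.
Qed.

Lemma hlength_subset (a b c : R) u : c <= b ->
  measurable_fun `[a, b] (fun t => (u t).1) ->
  measurable_fun `[a, b] (fun t => (u t).2) ->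
  (hlength `[a, c] u <= hlength `[a, b] u)%E.
Proof.
move=> cb m1 m2; apply: ge0_subset_integral => //.
- by apply/(measurable_EFinP _ (fun t => hnorm (u t))); apply: measurable_hnorm.
- by move=> t _; rewrite lee_fin hnorm_ge0.
- by apply: subset_itvl; rewrite bnd_simp.
Qed.

(** A competitor might leave the strip where the gradient is a unit vector. One shorter than the
    claimed bound cannot: it starts at [x = 0] and [x] changes at most by length, so [|k x| <= 1]
    all along it. The growth of the calibration then contradicts its shortness. *)
Lemma calibration_le_dH (G : R -> R) (k M : R) (A B : heis R) :
  (forall r, r \in `]-M, M[ -> is_derive r (1 : R) G (Num.sqrt (1 - (k * r) ^+ 2))) ->
  `|calibration G k B - calibration G k A| < M ->
  `|k| * `|calibration G k B - calibration G k A| <= 1 ->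
  cx A = 0 ->
  (`|calibration G k B - calibration G k A|%:E <= dH A B)%E.
Proof.
set s := `|_ - _|; move=> dG sM ks A0.
apply: le_ereal_inf_tmp => l [a [b [g [u [ab gu gA gB ->]]]]].
have [/lipschitz_heisP[/lipschitzP[k1 Lx] /lipschitzP[k2 Ly] /lipschitzP[k3 Lz]]
  m1 m2 _ du] := gu.
rewrite leNgt; apply/negP => ls.
have aab : a \in `[a, b] by rewrite in_itv /= lexx.
have xs t : t \in `[a, b] -> `|cx (g t)| < s.
  move=> tab; rewrite -[cx (g t)]subr0 -A0 -gA -lte_fin; apply: le_lt_trans ls.
  have /andP[at_ tb] : a <= t <= b by move: tab; rewrite in_itv.
  have sub r : r \in `[a, t] -> r \in `[a, b].
    by rewrite !in_itv /= => /andP[-> /le_trans->].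
  apply: (@le_trans _ _ (hlength `[a, t] u)); last exact: hlength_subset.
  have sub' : `[a, t] `<=` `[a, b] by move=> r /= /sub.
  apply: (@horizontal_growth (fun t => cx (g t)) a t k1) => //.
  - by move=> r r' /sub rI /sub r'I; exact: Lx.
  - exact: measurable_funS m1.
  - exact: measurable_funS m2.
  - apply: lebesgue_aeS du => r dr /sub /dr /has_velocityP[dx _ _].
    by exists (u r).1; split=> //; exact: fst_le_hnorm.
have s0 : 0 <= s by exact: normr_ge0.
have ks1 r : `|r| <= s -> 0 <= 1 - (k * r) ^+ 2.
  move=> rs; rewrite subr_ge0 -real_normK ?num_real// expr_le1//.
  by rewrite normrM; apply: le_trans ks; rewrite ler_wpM2l.
have sMI r : `|r| <= s -> r \in `]-M, M[.
  by move=> rs; rewrite in_itv /= -ltr_norml; apply: le_lt_trans sM.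
have LG r r' : `|r| <= s -> `|r'| <= s -> `|G r - G r'| <= `|r - r'|.
  move=> rs r's; rewrite -[leRHS]mul1r.
  apply: (lipschitz_of_derive (I := `]-M, M[) dG); [|exact: sMI|exact: sMI].
  move=> v vM; rewrite ger0_norm ?sqrtr_ge0// -[leRHS]sqrtr1 ler_wsqrtr//.
  by rewrite gerBl sqr_ge0.
pose f t := calibration G k (g t).
have yb t : t \in `[a, b] -> `|cy (g t)| <= `|cy (g a)| + `|k2| * (b - a).
  move=> tab; rewrite -[cy (g t)](subrK (cy (g a))) addrC.
  apply: le_trans (ler_normD _ _) _; rewrite lerD2l.
  apply: le_trans (Ly t a tab aab) _; apply: (@le_trans _ _ (`|k2| * `|t - a|)).
    by rewrite ler_wpM2r// ler_norm.
  by move: tab; rewrite in_itv /= => /andP[at_ tb]; rewrite ler_wpM2l// ger0_norm ?subr_ge0// lerD2r.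
(* The product [x y] in the calibration is Lipschitz along the competitor because [x] is bounded
   there by [s] and [y] by [Y]. *)
pose Y := `|cy (g a)| + `|k2| * (b - a).
have Lf : exists K, forall r t, r \in `[a, b] -> t \in `[a, b] -> `|f r - f t| <= K * `|r - t|.
  exists (k1 + `|k| * (k3 + (s * k2 + Y * k1) / 2)) => r t rI tI.
  rewrite /f /calibration.
  have -> : G (cx (g r)) + k * (cz (g r) + cx (g r) * cy (g r) / 2) -
      (G (cx (g t)) + k * (cz (g t) + cx (g t) * cy (g t) / 2)) =
      (G (cx (g r)) - G (cx (g t))) + k * ((cz (g r) - cz (g t)) +
        (cx (g r) * (cy (g r) - cy (g t)) + cy (g t) * (cx (g r) - cx (g t))) / 2).
    by ring.
  rewrite [leRHS]mulrDl; apply: le_trans (ler_normD _ _) _; apply: lerD.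
    by apply: le_trans (LG _ _ (ltW (xs r rI)) (ltW (xs t tI))) _; exact: Lx.
  rewrite normrM -mulrA ler_wpM2l// [leRHS]mulrDl.
  apply: le_trans (ler_normD _ _) _; apply: lerD; first exact: Lz.
  have -> : (s * k2 + Y * k1) / 2 * `|r - t| =
      (s * (k2 * `|r - t|) + Y * (k1 * `|r - t|)) * 2^-1 by ring.
  rewrite normrM [`|2^-1|]ger0_norm ?invr_ge0// ler_wpM2r ?invr_ge0//.
  apply: le_trans (ler_normD _ _) _; rewrite !normrM; apply: lerD.
    by apply: ler_pM => //; [exact: ltW (xs r rI) | exact: Ly].
  by apply: ler_pM => //; [exact: yb | exact: Lx].
have [K LK] := Lf.
move: ls; rewrite ltNge => /negP; apply.
rewrite /s -gA -gB; apply: (horizontal_growth (f := f)) LK m1 m2 _ => //.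
apply: lebesgue_aeS du => t dt tab; have /has_velocityP[dx dy dz] := dt tab.
have xst := ltW (xs t tab).
set w := Num.sqrt (1 - (k * cx (g t)) ^+ 2).
(* The derivative along the competitor pairs the horizontal gradient [(w, k x)] with the
   velocity. *)
exists (w * (u t).1 + (k * cx (g t)) * (u t).2); split.
  have dGx := derive_compf (dG _ (sMI _ xst)) dx.
  rewrite [f](_ : _ = fun t => G (cx (g t)) + k * (cz (g t) + cx (g t) * cy (g t) * 2^-1))//.
  by derive by (rewrite /w; field).
have w2 : w ^+ 2 = 1 - (k * cx (g t)) ^+ 2 by rewrite sqr_sqrtr// ks1.
rewrite ler_norml; apply/andP; split; last by apply: hnorm_dual; rewrite w2 subrK.
rewrite lerNl opprD -!mulNr; apply: hnorm_dual.
rewrite [leLHS](_ : _ = w ^+ 2 + (k * cx (g t)) ^+ 2); first by rewrite w2 subrK.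
by ring.
Qed.

End Calibration.

(** * Constant characteristic deviation implies local minimality *)

Section ConstantCurvature.
Context {R : realType}.
Set Implicit Arguments.
Unset Strict Implicit.
Local Notation mu := (@lebesgue_measure R).

Lemma dH_le_unit_speed (a b : R) (g : R -> heis R) (u : R -> R * R) : a <= b ->
  (forall t, t \in `[a, b] -> has_velocity g t (u t)) ->
  (forall t, t \in `[a, b] -> hnorm (u t) = 1) ->
  (forall t, t \in `[a, b] -> {for t, continuous (fun s => (u s).1)}) ->
  (forall t, t \in `[a, b] -> {for t, continuous (fun s => (u s).2)}) ->
  (dH (g a) (g b) <= (b - a)%:E)%E.
Proof.
move=> ab gu u1 c1 c2.
have m1 := within_continuous_measurable c1.
have m2 := within_continuous_measurable c2.
rewrite -(hlength_unit ab m1 m2); last by apply: aeW => t; exact: u1.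
apply: dH_le_horizontal => //.
apply: (@horizontal_of_velocity _ _ _ _ 1 (b - a) a) => //.
- by move=> t /u1 ->.
- by rewrite in_itv /= lexx.
- move=> t; rewrite in_itv /= => /andP[at_ tb].
  by rewrite ger0_norm ?subr_ge0// lerD2r.
Qed.

Variables (I : interval R) (g : R -> heis R).
Hypothesis I_open : forall t, t \in I -> \forall s \near t, s \in I.
Hypothesis g_arc : smooth_horizontal_arclength I g.

Lemma velocity_continuous t : t \in I ->
  {for t, continuous (fun s => (velocity g s).1)} /\
  {for t, continuous (fun s => (velocity g s).2)}.
Proof.
move=> tI; have [d1 d2] := velocity_curvature I_open g_arc tI.
by split; [exact: is_derive_continuous d1 | exact: is_derive_continuous d2].
Qed.

Lemma dH_arclength_le s t : s \in I -> t \in I ->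
  (dH (g s) (g t) <= `|t - s|%:E)%E.
Proof.
have between a b r : a \in I -> b \in I -> r \in `[a, b] -> r \in I.
  by move=> aI bI; rewrite in_itv /=; exact: (@interval_is_interval _ I a b).
move=> sI tI; case: (leP s t) => [st|/ltW ts].
  rewrite ger0_norm ?subr_ge0//.
  have inI r := @between s t r sI tI.
  apply: (dH_le_unit_speed (u := velocity g) st) => r /inI rI.
  - exact: (has_velocity_velocity g_arc rI).
  - exact: (hnorm_velocity g_arc rI).
  - by have [] := velocity_continuous rI.
  - by have [] := velocity_continuous rI.
rewrite distrC ger0_norm ?subr_ge0//.
(* Competitors run forward in time, so the arc from [s] back to [t] is traversed in reverse. *)
pose f r := s + t - r.
have inI r : r \in `[t, s] -> f r \in I.
  move=> rI; apply: between tI sI _; move: rI; rewrite /f !in_itv /= => /andP[? ?].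
  by apply/andP; split; lra.
have df r : is_derive r (1 : R) f (- 1) by rewrite /f; derive by ring.
have -> : g s = g (f t) by rewrite /f addrK.
have -> : g t = g (f s) by rewrite /f addrAC subrr add0r.
apply: (dH_le_unit_speed (g := fun r => g (f r)) (u := fun r => (- (velocity g (f r)).1, - (velocity g (f r)).2)) ts) => r /inI rI.
- have /has_velocityP[dx dy dz] := has_velocity_velocity g_arc rI.
  apply/has_velocityP; split.
  + by apply: is_derive_eq (derive_compf (f := fun s => cx (g s)) dx (df r)) _; rewrite mulrN1.
  + by apply: is_derive_eq (derive_compf (f := fun s => cy (g s)) dy (df r)) _; rewrite mulrN1.
  + by apply: is_derive_eq (derive_compf (f := fun s => cz (g s)) dz (df r)) _; rewrite /=; ring.
- by rewrite /hnorm /= !sqrrN; exact: (hnorm_velocity g_arc rI).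
- have [d1 _] := velocity_curvature I_open g_arc rI.
  exact: is_derive_continuous (derive_oppf (derive_compf (f := fun s => (velocity g s).1) d1 (df r))).
- have [_ d2] := velocity_curvature I_open g_arc rI.
  exact: is_derive_continuous (derive_oppf (derive_compf (f := fun s => (velocity g s).2) d2 (df r))).
Qed.

Lemma constant_curvature_dH (k t0 : R) :
  (forall t, t \in I -> char_deviation g t = k) -> t0 \in I ->
  \forall s \near t0, dH (g t0) (g s) = `|s - t0|%:E.
Proof.
move=> hk t0I.
have n0 := velocity_norm g_arc t0I.
(* The rotation by minus the angle of the velocity at [t0], which it sends to [X1]. *)
pose c := (velocity g t0).1; pose d := - (velocity g t0).2.
have cd : c ^+ 2 + d ^+ 2 = 1 by rewrite /d sqrrN.
have [p pE] := motion_transitive c d (g t0) (0, 0, 0).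
pose f t := motion c d p (g t); pose v t := rotation c d (velocity g t).
have fv t : t \in I -> has_velocity f t (v t).
  by move=> tI; exact: (has_velocity_motion p cd (has_velocity_velocity g_arc tI)).
have dv t : t \in I -> is_derive t (1 : R) (fun s => (v s).1) (- (k * (v t).2)) /\
    is_derive t (1 : R) (fun s => (v s).2) (k * (v t).1).
  move=> tI; have [d1 d2] := velocity_curvature I_open g_arc tI.
  rewrite hk// in d1 d2; move: d1 d2; rewrite /v /rotation.
  move: (velocity g) => U d1 d2 /=.
  by split; derive by ring.
have nv t : t \in I -> (v t).1 ^+ 2 + (v t).2 ^+ 2 = 1.
  move=> tI; have := velocity_norm g_arc tI; rewrite /v /rotation.
  move: (velocity g t) => U <- /=.
  by rewrite -[RHS]mul1r -cd; ring.
have v01 : (v t0).1 = 1.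
  by rewrite -n0 /v /rotation /c /d; move: (velocity g t0) => U /=; ring.
have v02 : (v t0).2 = 0.
  by rewrite /v /rotation /c /d; move: (velocity g t0) => U /=; ring.
(* Both sides have derivative [k * (v t).1] and vanish at [t0]. *)
have kx t : t \in I -> (v t).2 = k * cx (f t).
  move=> tI; apply/eqP; rewrite -subr_eq0; apply/eqP.
  rewrite (derive0_constant (f := fun t => (v t).2 - k * cx (f t)) _ tI t0I).
    by rewrite v02 /f pE /cx /= mulr0 subr0.
  move=> r rI; have [_ d2] := dv r rI; have /has_velocityP[dx _ _] := fv r rI.
  by derive by ring.
have vc : {for t0, continuous (fun s => (v s).1)}.
  by have [d1 _] := dv t0 t0I; exact: is_derive_continuous d1.
have [e /= e0 eP] : \forall s \near t0, s \in I /\ 0 < (v s).1.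
  near=> s; split; first by near: s; exact: I_open.
  near: s; apply: (cvgr_gt _ vc); by rewrite v01 ltr01.
(* [e'] keeps the first velocity component positive and the strip [|x| < e'] within [|k x| <= 1];
   the 1 added to [|k|] covers [k = 0]. *)
have [e' e'0 [e'e ke']] : exists2 e' : R, 0 < e' & e' <= e /\ `|k| * e' <= 1.
  exists (Num.min e (`|k| + 1)^-1); first by rewrite lt_min e0 invr_gt0 ltr_wpDl.
  split; first by rewrite ge_min lexx.
  have k1 : 0 < `|k| + 1 by rewrite ltr_wpDl.
  apply: (@le_trans _ _ (`|k| * (`|k| + 1)^-1)).
    by rewrite ler_wpM2l// ge_min lexx orbT.
  by rewrite ler_pdivrMr// mul1r lerDl.
pose J := `]t0 - e', t0 + e'[.
have JP t : t \in J -> [/\ t \in I, 0 < (v t).1 & `|t - t0| < e'].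
  rewrite in_itv /= => /andP[t1 t2].
  have te : `|t - t0| < e' by rewrite ltr_norml; apply/andP; split; lra.
  have t0e : `|t0 - t| < e by rewrite distrC; exact: lt_le_trans te e'e.
  by have [tI vt] := eP t t0e; split.
have t0J : t0 \in J by rewrite in_itv /=; apply/andP; split; lra.
have Gc : continuous (fun r : R => Num.sqrt (1 - (k * r) ^+ 2)).
  move=> r; apply: continuous_comp; last exact: sqrt_continuous.
  exact: is_derive_continuous (derive_addf (derive_cstf 1 r)
    (derive_oppf (derive_expf 2 (derive_mulf (derive_cstf k r) (derive_idf r))))).
have [G dG] := continuous_antiderivative e' Gc.
have dfx r : r \in J -> is_derive r (1 : R) (fun s => cx (f s)) (v r).1.
  by move=> /JP[rI _ _]; have /has_velocityP[] := fv r rI.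
have v1 r : r \in J -> `|(v r).1| <= 1.
  by move=> /JP[rI _ _]; apply: le_trans (fst_le_hnorm _) _; rewrite /hnorm (nv _ rI) sqrtr1.
have x0 : cx (f t0) = 0 by rewrite /f pE.
have xJ t : t \in J -> `|cx (f t)| < e'.
  move=> tJ; have [_ _ te] := JP t tJ; apply: le_lt_trans te.
  have := lipschitz_of_derive dfx v1 tJ t0J.
  by rewrite x0 subr0 mul1r.
(* The calibration grows at unit speed along the curve: its derivative is
   [(v t).1 ^+ 2 + (k x) ^+ 2], the positivity of [(v t).1] having selected the square root. *)
pose F t := calibration G k (f t) - t.
have dF r : r \in J -> is_derive r (1 : R) F 0.
  move=> rJ; have [rI vr rt0] := JP r rJ.
  have /has_velocityP[dx dy dz] := fv r rI.
  have vE : Num.sqrt (1 - (k * cx (f r)) ^+ 2) = (v r).1.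
    by rewrite -kx// -(nv r rI) addrK sqrtr_sqr gtr0_norm.
  have xr : cx (f r) \in `]- e', e'[ by rewrite in_itv /= -ltr_norml xJ.
  have dGx := derive_compf (f := G) (g := fun s => cx (f s)) (dG _ xr) dx.
  rewrite vE in dGx.
  rewrite /F /calibration; eapply is_derive_eq; first by der_rule.
  have := nv r rI; rewrite kx//; move: (v r).1 => w nw.
  by rewrite -[in X in _ = X](subrr (w ^+ 2 + (k * cx (f r)) ^+ 2)) {2}nw; field.
have calE t : t \in J -> calibration G k (f t) - calibration G k (f t0) = t - t0.
  move=> tJ; have := derive0_constant dF tJ t0J; rewrite /F.
  by move: (calibration _ _ (f t)) (calibration _ _ (f t0)) => a b ab; lra.
near=> s; have sJ : s \in J by near: s; exact: near_mem_itvoo.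
have [sI _ se] := JP s sJ.
apply/eqP; rewrite eq_le (dH_arclength_le t0I sI) /=.
rewrite -(dH_motion p _ _ cd) -(calE s sJ).
apply: (calibration_le_dH (M := e') dG).
- by rewrite (calE s sJ).
- by rewrite (calE s sJ); apply: le_trans ke'; rewrite ler_wpM2l// ltW.
- exact: x0.
Unshelve. all: by end_near. Qed.

End ConstantCurvature.

(** * An explicit shorter competitor where the characteristic deviation is strictly monotone *)

Section Variation.
Context {R : realType}.
Set Implicit Arguments.
Unset Strict Implicit.
Local Notation mu := (@lebesgue_measure R).

(** The tangent line at 1 lies above the square root; it turns the speed of the competitor into a
    polynomial in [e]. *)
Lemma sqrt_le_mid (A : R) : 0 <= A -> Num.sqrt A <= (1 + A) / 2.
Proof.
move=> A0; have sA : Num.sqrt A ^+ 2 = A by rewrite sqr_sqrtr.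
have : 0 <= (Num.sqrt A - 1) ^+ 2 by exact: sqr_ge0.
rewrite -{3}sA; move: (Num.sqrt A) => r; rewrite sqrrB expr1n mulr1 => r1.
by rewrite ler_pdivlMr//; lra.
Qed.

(** [sg] is the sign of [h'] and [m] a lower bound for its size. The speed of the competitor is
    bounded by a function [k] with an explicit primitive [K], so one explicit [e] suffices and no
    limit as [e] tends to 0 is taken. *)
Lemma shorter_competitor (a b : R) (x y z u1 u2 h h' : R -> R) (sg m v1 v2 : R)
    (P Q : heis R) : a < b -> P = (x a, y a, z a) -> Q = (x b, y b, z b) ->
  (forall t, t \in `[a, b] -> is_derive t (1 : R) x (u1 t)) ->
  (forall t, t \in `[a, b] -> is_derive t (1 : R) y (u2 t)) ->
  (forall t, t \in `[a, b] -> is_derive t (1 : R) z ((x t * u2 t - y t * u1 t) / 2)) ->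
  (forall t, t \in `[a, b] -> is_derive t (1 : R) u1 (- (h t * u2 t))) ->
  (forall t, t \in `[a, b] -> is_derive t (1 : R) u2 (h t * u1 t)) ->
  (forall t, t \in `[a, b] -> is_derive t (1 : R) h (h' t)) ->
  (forall t, t \in `[a, b] -> {for t, continuous h'}) ->
  (forall t, t \in `[a, b] -> u1 t ^+ 2 + u2 t ^+ 2 = 1) ->
  v1 ^+ 2 + v2 ^+ 2 = 1 ->
  (forall t, t \in `[a, b] -> v1 * u2 t - v2 * u1 t != 0) ->
  sg ^+ 2 = 1 -> 0 < m -> (forall t, t \in `[a, b] -> m <= sg * h' t) ->
  (dH P Q < (b - a)%:E)%E.
Proof.
move=> ab -> -> dx dy dz du1 du2 dh h'c nu nv w0 sg2 m0 mh'.
have aab : a \in `[a, b] by rewrite in_itv /= lexx ltW.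
have bab : b \in `[a, b] by rewrite in_itv /= lexx ltW.
(* [w] and [q] are the determinant and the scalar product of the constant vector [v] with the
   velocity. *)
pose w t := v1 * u2 t - v2 * u1 t.
pose q t := v1 * u1 t + v2 * u2 t.
pose wi t := (w t)^-1.
pose psi t := ((t - a) * (b - t)) ^+ 2.
pose dpsi t := 2 * (t - a) * (b - t) * (a + b - 2 * t).
pose ddpsi t := 2 * ((b - t) * (a + b - 2 * t) - (t - a) * (a + b - 2 * t)
   - 2 * (t - a) * (b - t)).
pose phi t := dpsi t * wi t.
pose dphi t := ddpsi t * wi t - dpsi t * (h t * q t) * wi t ^+ 2.
have dw t (tI : t \in `[a, b]) : is_derive t (1 : R) w (h t * q t).
  have ? := du1 t tI; have ? := du2 t tI.
  by rewrite /w; derive by (rewrite /q; ring).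
have dq t (tI : t \in `[a, b]) : is_derive t (1 : R) q (- (h t * w t)).
  have ? := du1 t tI; have ? := du2 t tI.
  by rewrite /q; derive by (rewrite /w; ring).
have dwi t (tI : t \in `[a, b]) : is_derive t (1 : R) wi (- (h t * q t) * wi t ^+ 2).
  have := derive_invf (f := w) (w0 t tI) (dw t tI).
  by rewrite -[(w t ^+ 2)^-1]exprVn.
have wiw t (tI : t \in `[a, b]) : wi t * w t = 1 by rewrite mulVf// w0.
have dpsi_ t : is_derive t (1 : R) psi (dpsi t).
  by rewrite /psi; derive by (rewrite /dpsi /=; ring).
have ddpsi_ t : is_derive t (1 : R) dpsi (ddpsi t).
  by rewrite /dpsi; derive by (rewrite /ddpsi /=; ring).
have dphi_ t (tI : t \in `[a, b]) : is_derive t (1 : R) phi (dphi t).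
  have ? := dwi t tI; have ? := ddpsi_ t.
  by rewrite /phi; derive by (rewrite /dphi; ring).
have ddphi t (tI : t \in `[a, b]) : exists d, is_derive t (1 : R) dphi d.
  have ? := dwi t tI; have ? := ddpsi_ t; have ? := dh t tI; have ? := dq t tI.
  by rewrite /dphi /ddpsi; eexists; der_rule.
have dphic t (tI : t \in `[a, b]) : {for t, continuous dphi}.
  by have [d dd] := ddphi t tI; exact: is_derive_continuous dd.
have [C C0 dphiC] : exists2 C, 0 <= C & forall t, t \in `[a, b] -> dphi t ^+ 2 <= C.
  have [|c cI cmax] := @EVT_max R (fun t => dphi t ^+ 2) a b (ltW ab).
    apply/subspace_continuousP => t tab; apply: cvg_within_filter.
    have [d dd] := ddphi t tab.
    exact: is_derive_continuous (derive_expf 2 dd).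
  by exists (dphi c ^+ 2) => //; exact: sqr_ge0.
(* With [L = b - a], the length saved is at least [e L / 2] times [m L ^ 4 / 15 - e C], which this
   [e] makes positive; [C + 1] avoids a zero denominator and gives strictness. *)
pose e := m * (b - a) ^+ 4 / (15 * (C + 1)).
have L0 : 0 < b - a by rewrite subr_gt0.
have C1 : 0 < C + 1 by rewrite ltr_wpDl.
have e0 : 0 < e by rewrite divr_gt0// mulr_gt0// exprn_gt0.
have eC : e * C < m * (b - a) ^+ 4 / 15.
  apply: (@lt_le_trans _ _ (e * (C + 1))); first by rewrite ltr_pM2l// ltrDl.
  by rewrite /e invfM mulrA -mulrA mulVf ?mulr1// gt_eqF.
pose E := sg * e.
(* [k] is the second-order bound of the speed plus the nonnegative term
   [e * psi t * (sg * h' t - m)], chosen so that [k] has an explicit primitive. The factor [h'],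
   assumed continuous only, is kept apart from the differentiable [A] and [B]. *)
pose A t := 1 + E * (dphi t * q t) - e * m * psi t + e ^+ 2 * C / 2.
pose B t := E * psi t.
pose k t := A t + B t * h' t.
(* The primitive of [psi] vanishing at [a]; its value at [b] is [(b - a) ^ 5 / 30]. *)
pose Psi t := (b - a) ^+ 2 * (t - a) ^+ 3 / 3 - (b - a) * (t - a) ^+ 4 / 2 + (t - a) ^+ 5 / 5.
have dPsi t : is_derive t (1 : R) Psi (psi t).
  by rewrite /Psi; derive by (rewrite /psi /=; field).
(* phi' q = (phi q + h psi)' - h' psi, because q' = - h w and phi w = psi'. *)
pose K t := t + E * (phi t * q t + h t * psi t) - e * m * Psi t + e ^+ 2 * C / 2 * t.
have dK t (tI : t \in `[a, b]) : is_derive t (1 : R) K (k t).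
  have ? := dphi_ t tI; have ? := dq t tI; have ? := dh t tI.
  have ? := dpsi_ t; have ? := dPsi t; rewrite /K; derive by idtac.
  have := wiw t tI; rewrite /k /A /B /phi.
  move: (w t) (wi t) (dpsi t) (h t) (q t) (psi t) (dphi t) (h' t) => w' i p' r' q' p d d' iw.
  have {}iw : w' * i = 1 by rewrite mulrC.
  by ring: iw.
have kc t (tI : t \in `[a, b]) : {for t, continuous k}.
  apply: cvgD; last apply: cvgM; last exact: h'c.
    have [d ?] := ddphi t tI; have ? := dq t tI; have ? := dpsi_ t.
    have [d' dA] : exists d', is_derive t (1 : R) A d' by rewrite /A; eexists; der_rule.
    exact: is_derive_continuous dA.
  exact: is_derive_continuous (derive_mulf (derive_cstf E t) (dpsi_ t)).
have kcw : {within `[a, b], continuous k}.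
  by apply/subspace_continuousP => t tab; apply: cvg_within_filter; exact: kc.
pose u t : R * R := (u1 t + E * dphi t * v1, u2 t + E * dphi t * v2).
(* The height is dictated by horizontality: the term in [E ^ 2] drops since [v] is parallel to
   itself, and [phi * w = dpsi] integrates to [psi]. As [phi] and [psi] vanish at both ends, the
   endpoints are kept. *)
pose g t : heis R := (x t + E * phi t * v1, y t + E * phi t * v2,
  z t + E * (phi t * (x t * v2 - y t * v1) / 2 + psi t)).
have psi0 t : t \in `[a, b] -> 0 <= psi t by move=> _; exact: sqr_ge0.
have uk t (tI : t \in `[a, b]) : hnorm (u t) <= k t.
  have sqE : (u t).1 ^+ 2 + (u t).2 ^+ 2 = 1 + 2 * E * dphi t * q t + E ^+ 2 * dphi t ^+ 2.
    rewrite /u /q /=; have := nu t tI; move: (u1 t) (u2 t) (dphi t) => a1 a2 d.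
    move=> na; have na' : a1 ^+ 2 = 1 - a2 ^+ 2 by rewrite -na addrK.
    have nv' : v1 ^+ 2 = 1 - v2 ^+ 2 by rewrite -nv addrK.
    by ring: na' nv'.
  rewrite /hnorm sqE; apply: le_trans (sqrt_le_mid _) _.
    by rewrite -sqE addr_ge0// sqr_ge0.
  have E2 : E ^+ 2 = e ^+ 2 by rewrite /E exprMn sg2 mul1r.
  have : e ^+ 2 * dphi t ^+ 2 <= e ^+ 2 * C by rewrite ler_wpM2l ?sqr_ge0 ?dphiC.
  have : e * psi t * m <= e * psi t * (sg * h' t).
    by rewrite ler_wpM2l ?mh'// mulr_ge0 ?psi0// ltW.
  rewrite /k /A /B E2; have -> : E * psi t * h' t = e * psi t * (sg * h' t) by rewrite /E; ring.
  rewrite ler_pdivrMr//.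
  move: (e ^+ 2 * dphi t ^+ 2) (e ^+ 2 * C) (e * psi t * (sg * h' t)) => X1 X2 X3.
  have -> : e * m * psi t = e * psi t * m by ring.
  have -> : 2 * E * dphi t * q t = 2 * (E * (dphi t * q t)) by ring.
  by move: (e * psi t * m) (E * (dphi t * q t)) => X4 X5; lra.
have gu t (tI : t \in `[a, b]) : has_velocity g t (u t).
  have ? := dx t tI; have ? := dy t tI; have ? := dz t tI; have ? := dphi_ t tI.
  have ? := dpsi_ t.
  apply/has_velocityP; split.
  - rewrite [X in is_derive _ _ X](_ : _ = fun s => x s + E * phi s * v1)//.
    by derive by (rewrite /u /=; ring).
  - rewrite [X in is_derive _ _ X](_ : _ = fun s => y s + E * phi s * v2)//.
    by derive by (rewrite /u /=; ring).
  - rewrite [X in is_derive _ _ X](_ : _ = fun s =>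
      z s + E * (phi s * (x s * v2 - y s * v1) / 2 + psi s))//.
    derive by idtac.
    have -> : dpsi t = phi t * (v1 * u2 t - v2 * u1 t).
      by rewrite /phi -mulrA (wiw t tI) mulr1.
    rewrite /g /u /cx /cy /=.
    move: (phi t) (dphi t) (x t) (y t) (u1 t) (u2 t) (psi t) => p d x' y' a1 a2 s.
    by field.
have uc t (tI : t \in `[a, b]) : {for t, continuous (fun s => (u s).1)} /\
    {for t, continuous (fun s => (u s).2)}.
  have [d ?] := ddphi t tI; have ? := du1 t tI; have ? := du2 t tI.
  split.
    have [d' du] : exists d', is_derive t (1 : R) (fun s => u1 s + E * dphi s * v1) d'.
      by eexists; der_rule.
    exact: is_derive_continuous du.
  have [d' du] : exists d', is_derive t (1 : R) (fun s => u2 s + E * dphi s * v2) d'.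
    by eexists; der_rule.
  exact: is_derive_continuous du.
have m1 : measurable_fun `[a, b] (fun t => (u t).1).
  by apply: within_continuous_measurable => t tI; have [] := uc t tI.
have m2 : measurable_fun `[a, b] (fun t => (u t).2).
  by apply: within_continuous_measurable => t tI; have [] := uc t tI.
have [c cI kmax] := EVT_max (ltW ab) kcw.
have hg : horizontal `[a, b] g u.
  apply: (@horizontal_of_velocity _ _ _ _ (k c) (b - a) a gu _ m1 m2 aab).
    by move=> t tI; apply: le_trans (uk t tI) (kmax t tI).
  move=> t; rewrite in_itv /= => /andP[at_ tb].
  by rewrite ger0_norm ?subr_ge0// lerD2r.
have gE t : phi t = 0 -> psi t = 0 -> g t = (x t, y t, z t).
  by rewrite /g => -> ->; congr (_, _, _); ring.
have phia : phi a = 0 by rewrite /phi /dpsi subrr mulr0 !mul0r.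
have phib : phi b = 0 by rewrite /phi /dpsi subrr mulr0 !mul0r.
have psia : psi a = 0 by rewrite /psi subrr mul0r expr0n.
have psib : psi b = 0 by rewrite /psi subrr mulr0 expr0n.
rewrite -(gE a phia psia) -(gE b phib psib).
apply: le_lt_trans (dH_le_horizontal (ltW ab) hg) _.
apply: (@le_lt_trans _ _ (\int[mu]_(t in `[a, b]) (k t)%:E)%E).
  apply: ge0_le_integral => //.
  - by move=> t _; rewrite lee_fin hnorm_ge0.
  - by apply/(measurable_EFinP _ (fun t => hnorm (u t))); apply: measurable_hnorm.
  - by apply/(measurable_EFinP _ k); exact: within_continuous_measurable.
rewrite (continuous_FTC2_itvcc (ltW ab) dK kcw) lte_fin -subr_gt0.
rewrite /K phia phib psia psib.
rewrite [ltRHS](_ : _ = e * (b - a) / 2 * (m * (b - a) ^+ 4 / 15 - e * C)).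
  apply: mulr_gt0; first by apply: divr_gt0 => //; exact: mulr_gt0.
  by rewrite subr_gt0.
by rewrite /Psi; field.
Qed.

End Variation.

(** * Geodesics are the curves of constant characteristic deviation *)

Section GeodesicsAndCurvature.
Context {R : realType}.
Set Implicit Arguments.
Unset Strict Implicit.
Local Notation mu := (@lebesgue_measure R).

Variables (T : R) (zeta : R -> heis R).
Hypothesis T_gt0 : 0 < T.
Hypothesis zeta_arc : smooth_horizontal_arclength `]- T, T[ zeta.
Local Notation I := (`]- T, T[ : interval R).

Let I_open t : t \in I -> \forall s \near t, s \in I.
Proof. exact: near_mem_itvoo. Qed.

Let O_in : 0 \in I.
Proof. by rewrite in_itv /= oppr_lt0 T_gt0. Qed.

Let between (a b : R) : a \in I -> b \in I -> `[a, b] `<=` [set` I].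
Proof.
move=> aI bI r; rewrite /= in_itv /=; exact: (@interval_is_interval _ I a b).
Qed.

Let measurable_velocity : measurable_fun [set` I] (fun t => (velocity zeta t).1) /\
  measurable_fun [set` I] (fun t => (velocity zeta t).2).
Proof.
have oI : open [set` I] by exact: interval_open.
by split; apply: open_continuous_measurable_fun => // t; rewrite inE => tI;
  have [] := velocity_continuous I_open zeta_arc tI.
Qed.

Lemma horizontal_velocity : horizontal I zeta (velocity zeta).
Proof.
have [m1 m2] := measurable_velocity.
apply: (@horizontal_of_velocity _ _ _ _ 1 T 0 _ _ m1 m2 O_in).
- by move=> t tI; exact: (has_velocity_velocity zeta_arc tI).
- by move=> t tI; rewrite (hnorm_velocity zeta_arc tI).
- by move=> t; rewrite subr0 in_itv /= -ltr_norml => /ltW.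
Qed.

Lemma constant_curvature_geodesic :
  (forall t, t \in I -> derive1 (char_deviation zeta) t = 0) -> geodesic I zeta.
Proof.
move=> dh; have hk t : t \in I -> char_deviation zeta t = char_deviation zeta 0.
  move=> tI; apply: (derive0_constant _ tI O_in) => r rI.
  have dhr := derive_char_deviation I_open zeta_arc rI.
  by rewrite -(dh r rI) derive1E; have [dr _] := dhr; exact: derivableP.
have [m1 m2] := measurable_velocity.
exists (velocity zeta); split; first exact: horizontal_velocity.
  by exists 1; apply: aeW => t tI; exact: (hnorm_velocity zeta_arc tI).
move=> t tI; have := constant_curvature_dH I_open zeta_arc hk tI.
apply: filterS => s -> sI.
have mI : Num.min t s \in I by case: leP.
have MI : Num.max t s \in I by case: leP.
have sub := between mI MI.
rewrite hlength_unit.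
- by congr (_%:E); case: (leP t s) => ts; [rewrite ger0_norm ?subr_ge0|rewrite ltr0_norm ?opprB ?subr_lt0].
- by rewrite ge_min !le_max !lexx.
- exact: measurable_funS m1.
- exact: measurable_funS m2.
- by apply: aeW => r /sub rI; exact: (hnorm_velocity zeta_arc rI).
Qed.

(** The velocity [u] is known only almost everywhere, but there it coincides with [velocity zeta] by
    uniqueness of derivatives, so length is elapsed time. *)
Lemma geodesic_unit_speed u a b : horizontal I zeta u -> a \in I -> b \in I ->
  a <= b -> hlength `[a, b] u = (b - a)%:E.
Proof.
move=> [_ m1 m2 _ du] aI bI ab; have sub := between aI bI.
apply: hlength_unit => //.
- exact: measurable_funS m1.
- exact: measurable_funS m2.
- apply: lebesgue_aeS du => t du /sub tI.
  have /has_velocityP[dx dy _] := du tI.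
  have /has_velocityP[dx' dy' _] := has_velocity_velocity zeta_arc tI.
  rewrite /hnorm (is_derive_inj dx dx') (is_derive_inj dy dy').
  exact: (hnorm_velocity zeta_arc tI).
Qed.

Lemma geodesic_constant_curvature : geodesic I zeta ->
  forall t, t \in I -> derive1 (char_deviation zeta) t = 0.
Proof.
move=> [u [hu _ umin]] t0 t0I; rewrite derive1E.
have dh t (tI : t \in I) := derive_char_deviation I_open zeta_arc tI.
have [_ ->] := dh t0 t0I; apply: contrapT => /eqP h0.
set h' := char_deviation' zeta in dh h0.
have h'c t (tI : t \in I) : {for t, continuous h'} := char_deviation'_continuous I_open zeta_arc tI.
pose sg := Num.sg (h' t0).
have sg2 : sg ^+ 2 = 1 by rewrite sqr_sg h0.
have h'0 : 0 < `|h' t0| / 2 by rewrite divr_gt0 ?normr_gt0.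
(* The velocity at [t0] turned clockwise by a quarter turn: its determinant [w] with the velocity is
   1 at [t0], hence positive nearby. *)
pose v1 := (velocity zeta t0).2; pose v2 := - (velocity zeta t0).1.
have n0 := velocity_norm zeta_arc t0I.
have nv : v1 ^+ 2 + v2 ^+ 2 = 1 by rewrite /v2 sqrrN addrC.
pose w t := v1 * (velocity zeta t).2 - v2 * (velocity zeta t).1.
have w0 : w t0 = 1 by rewrite -n0 /w /v1 /v2; move: (velocity zeta t0) => U; ring.
have wc : {for t0, continuous w}.
  have [d1 d2] := velocity_curvature I_open zeta_arc t0I.
  exact: is_derive_continuous (derive_addf (derive_mulf (derive_cstf v1 t0) d2)
    (derive_oppf (derive_mulf (derive_cstf v2 t0) d1))).
have [e /= e0 eP] : \forall s \near t0, [/\ s \in I, 0 < w s & `|h' t0| / 2 < sg * h' s].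
  near=> s; split; first by near: s; exact: I_open.
    near: s; apply: (cvgr_gt _ wc); by rewrite w0 ltr01.
  near: s; have sc : sg * h' s @[s --> t0] --> sg * h' t0 by apply: cvgMr; exact: h'c.
  by apply: (cvgr_gt _ sc); rewrite /sg -normrEsg ltr_pdivrMr// ltr_pMr ?normr_gt0// ltr1n.
have [s [s0 sI se smin]] : exists s, [/\ t0 < s, s \in I, s - t0 < e &
    hlength `[t0, s] u = dH (zeta t0) (zeta s)].
  have [d /= d0 dP] := umin t0 t0I.
  (* Half the smaller radius lands strictly inside both neighbourhoods: the one where the curve
     minimizes and the one where [w] and [sg * h'] are controlled. *)
  pose f := Num.min d e / 2; have de0 : 0 < Num.min d e by rewrite lt_min d0.
  have f0 : 0 < f by rewrite divr_gt0.
  have fd : f < d by apply: (@lt_le_trans _ _ (Num.min d e)); rewrite ?ge_min ?lexx// /f ltr_pdivrMr// ltr_pMr// ltr1n.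
  have fe : f < e by apply: (@lt_le_trans _ _ (Num.min d e)); rewrite ?ge_min ?lexx ?orbT// /f ltr_pdivrMr// ltr_pMr// ltr1n.
  have fsub : `|t0 - (t0 + f)| = f by rewrite opprD addrA subrr sub0r normrN gtr0_norm.
  have fI : t0 + f \in I by have [] := eP (t0 + f); rewrite /= ?fsub.
  exists (t0 + f); split=> //; [by rewrite ltrDl | by rewrite addrAC subrr add0r|].
  have := dP (t0 + f); rewrite /= fsub => /(_ fd fI).
  by rewrite min_l ?max_r// lerDl ltW.
have inJ t : t \in `[t0, s] -> [/\ t \in I, 0 < w t & `|h' t0| / 2 < sg * h' t].
  rewrite in_itv /= => /andP[t1 t2]; apply: eP; rewrite /= distrC ger0_norm ?subr_ge0//.
  by apply: le_lt_trans se; rewrite lerD2r.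
have JI t (tI : t \in `[t0, s]) : t \in I by have [] := inJ t tI.
have dx t (tI : t \in `[t0, s]) : is_derive t (1 : R) (fun r => cx (zeta r)) (velocity zeta t).1.
  by have /has_velocityP[] := has_velocity_velocity zeta_arc (JI t tI).
have dy t (tI : t \in `[t0, s]) : is_derive t (1 : R) (fun r => cy (zeta r)) (velocity zeta t).2.
  by have /has_velocityP[] := has_velocity_velocity zeta_arc (JI t tI).
have dz t (tI : t \in `[t0, s]) : is_derive t (1 : R) (fun r => cz (zeta r))
    ((cx (zeta t) * (velocity zeta t).2 - cy (zeta t) * (velocity zeta t).1) / 2).
  by have /has_velocityP[] := has_velocity_velocity zeta_arc (JI t tI).
have du1 t (tI : t \in `[t0, s]) := proj1 (velocity_curvature I_open zeta_arc (JI t tI)).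
have du2 t (tI : t \in `[t0, s]) := proj2 (velocity_curvature I_open zeta_arc (JI t tI)).
have dhJ t (tI : t \in `[t0, s]) := dh t (JI t tI).
have hcJ t (tI : t \in `[t0, s]) := h'c t (JI t tI).
have nJ t (tI : t \in `[t0, s]) := velocity_norm zeta_arc (JI t tI).
have wJ t (tI : t \in `[t0, s]) : w t != 0 by have [_ wt _] := inJ t tI; rewrite gt_eqF.
have mJ t (tI : t \in `[t0, s]) : `|h' t0| / 2 <= sg * h' t by have [_ _ /ltW] := inJ t tI.
have heisE (p : heis R) : p = (cx p, cy p, cz p) by case: p => [[]].
(* The distance would be less than [s - t0], which is the length of the arc and, by minimality, the
   distance itself. *)
have := shorter_competitor s0 (heisE (zeta t0)) (heisE (zeta s)) dx dy dz du1 du2 dhJ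
  hcJ nJ nv wJ sg2 h'0 mJ.
by rewrite -smin (geodesic_unit_speed hu t0I sI (ltW s0)) ltxx.
Unshelve. all: by end_near. Qed.

End GeodesicsAndCurvature.

Theorem proposition1p1 (R : realType) (T : R) (T_gt0 : 0 < T) :
  (forall zeta1 zeta2 : R -> heis R,
     smooth_horizontal_arclength `]- T, T[ zeta1 ->
     smooth_horizontal_arclength `]- T, T[ zeta2 ->
     (forall t, t \in `]- T, T[ -> char_deviation zeta1 t = char_deviation zeta2 t) ->
     exists iota : heis R -> heis R,
       heis_isometry iota /\ forall t, t \in `]- T, T[ -> zeta2 t = iota (zeta1 t))
  /\
  (forall zeta : R -> heis R,
     smooth_horizontal_arclength `]- T, T[ zeta ->
     ((forall t, t \in `]- T, T[ -> derive1 (char_deviation zeta) t = 0)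
      <-> geodesic `]- T, T[ zeta)).
Proof.
split=> [zeta1 zeta2 arc1 arc2 h12|zeta arc].
  have O_in : 0 \in `]- T, T[ by rewrite in_itv /= oppr_lt0 T_gt0.
  have [c [s [p [cs zE]]]] := congruence (@near_mem_itvoo R (- T) T) O_in arc1 arc2 h12.
  by exists (motion c s p); split; [exact: motion_isometry | exact: zE].
split; first exact: constant_curvature_geodesic.
exact: geodesic_constant_curvature.
Qed.
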